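(* Let $\mathbf{k}=(k_1,\ldots,k_n)$ be a weak composition (a tuple of nonnegative integers). The sets $\mathrm{Slide}^\omega(\mathbf{k})$ and $\mathrm{Slide}^\psi(\mathbf{k})$ are, respectively, the sets of all trivalent trees (with leaves labeled by $a,b,c,1,\ldots,n$) that admit an $\omega$-type or $\psi$-type $\mathbf{k}$-slide labeling.
   Context: A tree whose leaves are bijectively labeled by a set $L$ is stable (at least trivalent) if it has no vertices of degree $2$ and at least one vertex of degree $\ge 3$; it is trivalent if every vertex has degree $1$ or $3$ and at least one vertex has degree $3$. Trees are considered up to label-preserving isomorphism. An internal vertex is a non-leaf vertex, and an internal edge is an edge joining two internal vertices. Labels are ordered $a<b<c<1<\cdots<n$. Slides. Let $T$ be a stable tree with leaves labeled by $a,b,c$ and some positive integers, and let $i\ge 1$ be a numbered leaf of $T$. Let $v_i$ be the internal vertex adjacent to leaf $i$. The branches of $T$ at $i$ are the connected components of $T\setminus\{v_i\}$ (vertex deletion); the root of a branch is its vertex attached to $v_i$ by an edge. Let $\mathrm{Br}_a$ be the branch containing $a$, $e_a$ the edge connecting $\mathrm{Br}_a$ to $v_i$, $m$ the minimal leaf label of $T\setminus(\mathrm{Br}_a\cup\{i\})$, and $\mathrm{Br}_m$ the branch containing $m$. An $i$-slide on $T$ is performed as follows: add a vertex $\overline{v}$ in the middle of $e_a$, move $\mathrm{Br}_m$ to attach its root to $\overline{v}$, and attach each remaining branch (other than $\mathrm{Br}_a$, $\mathrm{Br}_m$ and the leaf $i$, which stays at $v_i$) to either $v_i$ or $\overline{v}$.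 $\mathrm{slide}_i(T)$ is the set of stable trees obtained this way (stability requires at least one branch other than the leaf $i$ to remain at $v_i$, so $\mathrm{slide}_i(T)=\emptyset$ if $\deg v_i=3$). For a set $\mathbf{T}$ of trees, $\mathrm{slide}_i(\mathbf{T})=\bigcup_{T\in\mathbf{T}}\mathrm{slide}_i(T)$. $\mathrm{Slide}^\psi(\mathbf{k})$ is the set of stable trees obtained as follows: start with the tree with a single internal vertex and leaves $a,b,c,1,\ldots,n$; for $i=1,\ldots,n$ in order, perform $k_i$ successive $i$-slides in all possible ways. $\mathrm{Slide}^\omega(\mathbf{k})$ is the set of stable trees obtained as follows: start with the tree with a single internal vertex and leaves $a,b,c$; for $i=1,\ldots,n$ in order, first consider all trees formed by inserting a new leaf $i$ at any existing non-leaf vertex of a tree obtained so far, then perform $k_i$ successive $i$-slides in all possible ways. Slide labelings. The ($\omega$- or $\psi$-type) $\mathbf{k}$-slide labeling of a tree $T$ with leaves $a,b,c,1,\ldots,n$, if it exists, is the labeling of internal edges of $T$ formed by the following process (if the process terminates before completion, it does not exist). For $\ell=n,n-1,\ldots,1$ in order, perform steps (1)–(3) until $k_\ell$ internal edges of $T$ are labeled by $\ell$ (not at all if $k_\ell=0$): (1) Let $T'$ be the tree formed by contracting all internal edges of $T$ that are already labeled. (2) In $T'$, let $v_\ell$ be the internal vertex adjacent to leaf edge $\ell$. Let $e$ be the first edge on the path from $v_\ell$ to $a$, and let $\overline{v}$ be the other vertex of $e$. If $\overline{v}=a$, the process terminates; otherwise go to the next step. (3) Let $m_{v_\ell}$ (resp.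 $m_{\overline{v}}$) be the smallest label on any branch from $v_\ell$ (resp. $\overline{v}$) not containing $a$ or $\ell$ (branches from a vertex are the connected components after deleting that vertex). If $\ell>m_{v_\ell}>m_{\overline{v}}$ in the $\omega$ case, or if simply $m_{v_\ell}>m_{\overline{v}}$ in the $\psi$ case, label the edge $e$ by $\ell$ (in both $T'$ and $T$). Otherwise, the process terminates. The labeling is complete once all $\ell$ from $n$ down to $1$ have been processed.
   Formalization: The weak composition is assumed to satisfy k_1+...+k_n ≥ n; without this the claim is false, e.g. for n=1, k=(0) both Slide sets contain only the non-trivalent star with leaves a,b,c,1. *)

(* Defs.v *)
From mathcomp Require Import all_boot.

Set Implicit Arguments.
Unset Strict Implicit.
Unset Printing Implicit Defensive.

(* The label set {a < b < c < 1 < ... < n} is 'I_n.+3 with its usual order: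
   a, b, c are 0, 1, 2, and the integer label i >= 1 is i + 2. *)
Definition label_a {n : nat} : 'I_n.+3 := ord0.

(* The j-th integer label, counting from 0: j : 'I_n stands for j + 1. *)
Definition num_label {n : nat} (j : 'I_n) : 'I_n.+3 := rshift 3 j.

(* Finite graphs carrying m marked vertices; the conditions that make them
   leaf-labeled trees are in [labeled_tree] below. *)
Record lgraph (m : nat) : Type := LGraph {
  vert : finType;
  adj : rel vert;
  leaf : 'I_m -> vert
}.

Section Trees.
Variables (m : nat) (T : lgraph m).

Definition deg (v : vert T) : nat := #|[set w | adj v w]|.

Definition is_tree : Prop :=
  [/\ symmetric (@adj m T),
      irreflexive (@adj m T),
      (forall x y : vert T, connect (@adj m T) x y) &
      (forall p : seq (vert T), ucycle (@adj m T) p -> size p <= 2)].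

Definition labeled_tree : Prop :=
  [/\ is_tree,
      injective (@leaf m T) &
      forall v : vert T, (deg v == 1) = (v \in codom (@leaf m T))].

Definition stable : Prop :=
  [/\ labeled_tree,
      (forall v : vert T, deg v != 2) &
      (exists v : vert T, 3 <= deg v)].

Definition trivalent : Prop :=
  [/\ labeled_tree,
      (forall v : vert T, deg v = 1 \/ deg v = 3) &
      (exists v : vert T, deg v = 3)].

(* Branches at v: the connected components of T \ {v}. *)
Definition delete_vertex (v : vert T) : rel (vert T) :=
  [rel x y | [&& adj x y, x != v & y != v]].

Definition branches (v : vert T) : {set {set vert T}} :=
  [set [set y | connect (delete_vertex v) x y] | x in [set~ v]].

End Trees.

(* Trees are considered up to label-preserving isomorphism: every set of trees
   below is an isomorphism-invariant predicate on [lgraph]. *)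
Definition iso (m : nat) (T U : lgraph m) : Prop :=
  exists f : vert T -> vert U,
    [/\ bijective f,
        (forall x y, adj (f x) (f y) = adj x y) &
        (forall l, f (leaf T l) = leaf U l)].

(* The minimum of a set of labels, as a relation: it is not defined on the
   empty set. *)
Definition is_min (m : nat) (P : 'I_m -> Prop) (l : 'I_m) : Prop :=
  P l /\ forall l', P l' -> l <= l'.

Section Slides.
Variable n : nat.

(* The graph obtained from T by adding a vertex vbar (None) adjacent to v, and
   by re-attaching to vbar the neighbors of v that lie in W.  When W is a union
   of branches at v, these neighbors are the roots of those branches; for the
   branch containing a this amounts to subdividing the edge e_a. *)
Definition slid_graph (T : lgraph n.+3) (v : vert T) (W : {set vert T}) :
    lgraph n.+3 :=
  {| vert := option (vert T) : finType;
     adj := fun x y =>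
       match x, y with
       | Some x, Some y =>
           [&& adj x y, ~~ ((x == v) && (y \in W)) & ~~ ((y == v) && (x \in W))]
       | None, Some x | Some x, None => (x == v) || (adj v x && (x \in W))
       | None, None => false
       end;
     leaf := fun l => Some (leaf T l) |}.

(* M is the set of branches moved to vbar, besides Bra. *)
Definition slide (i : 'I_n.+3) (T T' : lgraph n.+3) : Prop :=
  exists (v : vert T) (Bra Brm : {set vert T}) (l : 'I_n.+3)
         (M : {set {set vert T}}),
    [/\ adj (leaf T i) v,
        Bra \in branches v /\ leaf T label_a \in Bra,
        is_min (fun l' => l' <> i /\ leaf T l' \notin Bra) l,
        Brm \in branches v /\ leaf T l \in Brm &
        [/\ M \subset branches v :\: [set Bra; [set leaf T i]],
            Brm \in M,
            iso (slid_graph v (Bra :|: cover M)) T' &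
            stable T']].

Definition slide_set (i : 'I_n.+3) (A : lgraph n.+3 -> Prop) :
    lgraph n.+3 -> Prop :=
  fun T' => exists2 T, A T & slide i T T'.

End Slides.

(* The tree with a single internal vertex (None). *)
Definition star (m : nat) : lgraph m :=
  {| vert := option 'I_m : finType;
     adj := fun x y => isSome x != isSome y;
     leaf := @Some 'I_m |}.

Definition Slide_psi (n : nat) (k : n.-tuple nat) : lgraph n.+3 -> Prop :=
  foldl (fun A (j : 'I_n) => iter (tnth k j) (slide_set (num_label j)) A)
        (iso (star n.+3)) (enum 'I_n).

(* Attaches to v a new leaf (None), whose label is the new largest one. *)
Definition insert_leaf (m : nat) (T : lgraph m) (v : vert T) : lgraph m.+1 :=
  {| vert := option (vert T) : finType;
     adj := fun x y =>
       match x, y with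
       | Some x, Some y => adj x y
       | None, Some x | Some x, None => x == v
       | None, None => false
       end;
     leaf := fun l => omap (leaf T) (unlift ord_max l) |}.

Definition insert_set (m : nat) (A : lgraph m -> Prop) : lgraph m.+1 -> Prop :=
  fun T' => exists2 T, A T &
    exists2 v : vert T, v \notin codom (leaf T) & iso (insert_leaf v) T'.

(* The trees obtained after treating the labels 1, ..., n; k is indexed
   from 0. *)
Fixpoint Slide_omega_upto (k : nat -> nat) (n : nat) : lgraph n.+3 -> Prop :=
  match n return lgraph n.+3 -> Prop with
  | 0 => iso (star 3)
  | j.+1 => iter (k j) (slide_set (ord_max : 'I_j.+4))
                 (insert_set (@Slide_omega_upto k j))
  end.

Definition Slide_omega (n : nat) (k : n.-tuple nat) : lgraph n.+3 -> Prop :=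
  @Slide_omega_upto (nth 0 k) n.

Variant slide_type : Set := Omega | Psi.

Section Labelings.
Variables (n : nat) (T : lgraph n.+3).

(* Partial edge labelings; the edge joining x and y is the set [set x; y]. *)
Definition edge_labeling : predArgType :=
  {ffun {set vert T} -> option 'I_n.+3}.

Definition labeled_edge (lab : edge_labeling) : rel (vert T) :=
  [rel x y | adj x y && isSome (lab [set x; y])].

(* The vertex of the contracted tree T' to which x is sent, as a set of
   vertices of T. *)
Definition contract_class (lab : edge_labeling) (x : vert T) : {set vert T} :=
  [set y | connect (labeled_edge lab) x y].

Definition contracted (lab : edge_labeling) : lgraph n.+3 :=
  {| vert := {B : {set vert T} | B \in codom (contract_class lab)} : finType;
     adj := fun B C =>
       (B != C) && [exists x in val B, exists y in val C, adj x y];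
     leaf := fun l =>
       exist (fun B => B \in codom (contract_class lab))
             (contract_class lab (leaf T l))
             (codom_f (contract_class lab) (leaf T l)) |}.

End Labelings.

(* The vertex following v on the path from v to w. *)
Definition first_step (m : nat) (U : lgraph m) (v w u : vert U) : Prop :=
  exists p : seq (vert U),
    [/\ path (@adj m U) v (u :: p), uniq [:: v, u & p] & last u p = w].

(* x is the smallest label on a branch from v containing neither a nor l. *)
Definition is_branch_min (n : nat) (U : lgraph n.+3) (l : 'I_n.+3) (v : vert U)
    (x : 'I_n.+3) : Prop :=
  is_min (fun y => exists2 B, B \in branches v &
    [/\ leaf U y \in B, leaf U label_a \notin B & leaf U l \notin B]) x.

(* One pass through steps (1)-(3) for the label l; there is no lab' when the
   process terminates. *)
Definition label_step (n : nat) (ty : slide_type) (T : lgraph n.+3)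
    (l : 'I_n.+3) (lab lab' : edge_labeling T) : Prop :=
  let T' := contracted lab in
  exists (v vbar : vert T') (mv mvbar : 'I_n.+3) (x y : vert T),
    [/\ adj (leaf T' l) v,
        first_step v (leaf T' label_a) vbar /\ vbar <> leaf T' label_a,
        is_branch_min l v mv /\ is_branch_min l vbar mvbar,
        match ty with
        | Omega => mv < l /\ mvbar < mv
        | Psi => mvbar < mv
        end &
        [/\ x \in val v, y \in val vbar, adj x y &
            lab' = [ffun e => if e == [set x; y] then Some l else lab e]]].

Definition label_step_set (n : nat) (ty : slide_type) (T : lgraph n.+3)
    (l : 'I_n.+3) (A : edge_labeling T -> Prop) : edge_labeling T -> Prop :=
  fun lab' => exists2 lab, A lab & label_step ty l lab lab'.

(* The fold treats the labels n, n-1, ..., 1 in this order. *)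
Definition slide_labeling (n : nat) (ty : slide_type) (k : n.-tuple nat)
    (T : lgraph n.+3) : edge_labeling T -> Prop :=
  foldl (fun A (j : 'I_n) =>
           iter (tnth k j) (label_step_set ty (num_label j)) A)
        (eq [ffun=> None]) (rev (enum 'I_n)).

Definition admits_slide_labeling (n : nat) (ty : slide_type) (k : n.-tuple nat)
    (T : lgraph n.+3) : Prop :=
  exists lab : edge_labeling T, slide_labeling ty k lab.

(* Main.v *)
Require Import Defs.
From mathcomp Require Import all_boot zify.

(** A slide creates one internal edge, and contracting that edge undoes it. So
    the trees of which a given stable tree [U] is an [i]-slide are among the
    trees [U / xy] with [xy] an edge, and the question is which edges are
    allowed. The answer is [unslide]: leaf [i] hangs at [x], the path from [x]
    to [a] goes through [y] to a further vertex [r], and the smallest label on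
    the [x] side of [xy], apart from [i], exceeds the smallest label found on
    the [y] side outside the branch of [a]. Indeed, the union of these two sets
    of labels is the set of labels of [U / xy] off the branch of [a], so that
    the inequality says that the branch of the overall minimum was moved to [y]
    ([slide_unslide], [unslide_slide]). The same inequality decides whether a
    step of the labeling process may label [xy] ([label_stepP]).

    Hence, for a class [A] of trees and a partial labeling [lab] of [T], the
    contracted tree [T / lab] is a slide of a tree of [A] exactly when one
    labeling step leads from [lab] to some [lab'] with [T / lab'] in [A]
    ([psi_step]). Iterated, this reads the construction of [T] from the star
    backwards as a labeling of [T] ([psi_fold]); it remains to see that a
    complete labeling ends at the star. Every labeling step lowers the number
    of vertices by one, and a stable tree with [n + 3] leaves has at least
    [n + 4] vertices, with equality for the star, and at most [2 n + 4], with
    equality only when it is trivalent. As at least [n] edges are labeled, a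
    labeled stable tree is trivalent and its full contraction is the star.

    In the omega construction the tree built with the labels up to [t] is
    compared with [T / lab] deprived of the leaves above [t]. Removing a leaf is
    again a contraction, that of the edge at the leaf, and it preserves
    [unslide] because the bound [i > m_v] forces both minima to be labels that
    are kept ([unslide_prune], [unslide_unprune]). Between two rounds the last
    leaf is removed. The result is stable unless the neighbour [v] of that leaf
    has only three neighbours; but then no later step can contract an edge at
    [v], since one of its two minima would have to be the removed label
    ([narrow_unslide]), so [v] would still have three neighbours in the final
    star, whose centre has at least four.

    All conditions on trees are phrased with [side x y], the component of [x]
    once the edge [xy] is deleted, because contractions respect the sides of
    the edges that they do not collapse ([contr_side]). *)

Set Implicit Arguments.
Unset Strict Implicit.
Unset Printing Implicit Defensive.

(** * Trees through their bridges *)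

Lemma connect_induct (V : finType) (e : rel V) (P : V -> Prop) x y :
  P x -> (forall u w, P u -> e u w -> P w) -> connect e x y -> P y.
Proof.
move=> Px closP /connectP[p]; elim: p x Px => [|z p IHp] x Px /=; first by move=> _ ->.
by case/andP=> exz pz; apply: IHp pz; apply: closP exz.
Qed.

Lemma connect_const (V : finType) (S : Type) (e : rel V) (g : V -> S) x y :
  (forall u w, e u w -> g u = g w) -> connect e x y -> g x = g y.
Proof.
move=> ge; apply: (@connect_induct _ _ (fun w => g x = g w)) => // u w -> /ge.
by [].
Qed.

Section Trees.
Variables (m : nat) (T : lgraph m).
Implicit Types u v w x y z : vert T.

Definition cut x y : rel (vert T) :=
  [rel u w | adj u w && ~~ ((u == x) && (w == y) || (u == y) && (w == x))].

Definition side x y w : bool := connect (cut x y) x w.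

(** Acyclicity in the form that passes to quotients: a path in a quotient that
    avoids an edge lifts to a path that avoids the edge above it. *)
Definition bridged : Prop :=
  [/\ symmetric (@adj m T), irreflexive (@adj m T),
      (forall x y, connect (@adj m T) x y) &
      (forall x y, adj x y -> ~~ side x y y)].

Lemma cutC x y : cut x y =2 cut y x.
Proof. by move=> u w; rewrite /cut /= orbC. Qed.

Lemma sideC x y w : side y x w = connect (cut x y) y w.
Proof. exact: (eq_connect (cutC _ _)). Qed.

Lemma side_refl x y : side x y x.
Proof. exact: connect0. Qed.

Lemma side_step x y u w : cut x y u w -> side x y u -> side x y w.
Proof. by move=> cuw xu; apply: connect_trans xu (connect1 cuw). Qed.

Lemma tree_bridged : is_tree T -> bridged.
Proof.
case=> sT iT cT acT; split=> // x y axy; apply/negP.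
case/connectP=> p0 pth0 lastp0; case/shortenP: pth0 lastp0 => p pth up _ lastp.
have neq_xy : x != y by apply: contraTneq axy => ->; rewrite iT.
have: size (x :: p) <= 2.
  apply: acT; apply/andP; split=> //=.
  rewrite rcons_path -lastp sT axy andbT.
  by apply: sub_path pth => u w /= /andP[].
case: p pth up lastp => [|z [|//]] /=; first by move=> _ _ /esym/eqP/negPn; rewrite neq_xy.
by move=> /andP[/andP[_ h] _] _ e _; move: h; rewrite e !eqxx.
Qed.

Lemma bridged_tree : bridged -> is_tree T.
Proof.
case=> sT iT cT bT; split=> // -[|x [|y [|z p]]] //= /andP[cyc uq].
exfalso; move: cyc uq => /= /and3P[axy ayz pth].
rewrite !inE !negb_or => /and4P[/and3P[nxy nxz nxp] /andP[nyz nyp] _ _].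
have: side y x z.
  by apply: side_step (side_refl _ _); rewrite /cut /= ayz !eqxx /=
    (eq_sym z) (negPf nxz) (eq_sym y) (negPf nxy).
elim: p z pth {ayz} nxz nxp nyz nyp => [|w p IHp] z /= + nxz + nyz.
  rewrite andbT => azx _ _ syz; have := bT _ _ axy; case/negP; rewrite -sT in axy.
  have: side y x x.
    by apply: side_step syz; rewrite /cut /= azx (eq_sym z) (negPf nyz) (eq_sym z) (negPf nxz).
  by move/negP: (bT _ _ axy).
case/andP=> azw pth; rewrite !inE !negb_or => /andP[nxw nxp] /andP[nyw nyp] syz.
apply: (IHp w) => //; apply: side_step syz.
by rewrite /cut /= azw (eq_sym z) (negPf nyz) (eq_sym z) (negPf nxz).
Qed.

Hypothesis bT : bridged.

Let sT : symmetric (@adj m T). Proof. by case: bT. Qed.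
Let iT : irreflexive (@adj m T). Proof. by case: bT. Qed.
Let cT : forall x y, connect (@adj m T) x y. Proof. by case: bT. Qed.

Lemma adj_neq x y : adj x y -> x != y.
Proof. by apply: contraTneq => ->; rewrite iT. Qed.

Lemma cut_sym x y : symmetric (cut x y).
Proof.
move=> u w; rewrite /cut /= sT; congr (_ && ~~ _).
by rewrite orbC andbC [(u == x) && _]andbC.
Qed.

Lemma cut_adj x y u w : cut x y u w -> adj u w.
Proof. by case/andP. Qed.

Lemma cut_intro x y u w : adj u w -> u != y -> w != y -> cut x y u w.
Proof. by rewrite /cut /= => -> /negPf-> /negPf->; rewrite andbF. Qed.

Lemma side_far x y : adj x y -> side x y y = false.
Proof. by case: bT => _ _ _ b /b/negPf. Qed.

(** Any path starting at [x] stays in the union of the two sides, and a vertex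
    in both would give a detour around the bridge. *)
Lemma side_neg x y w : adj x y -> side y x w = ~~ side x y w.
Proof.
move=> axy; apply/idP/idP => [yw|].
  apply/negP => xw; case/negP: (negbT (side_far axy)); apply: connect_trans xw _.
  by rewrite (sym_connect_sym (@cut_sym x y)) -sideC.
suff: side x y w || side y x w by case: (side x y w).
apply: (@connect_induct _ _ (fun z => side x y z || side y x z) _ _ _ _ (cT x w))
    => [|u u' IH auu']; first by rewrite side_refl.
have [cuu'|/negPf ncut] := boolP (cut x y u u').
  case/orP: IH => h; first by rewrite (side_step cuu' h).
  by rewrite (@side_step y x u u') ?orbT // cutC.
move: ncut; rewrite /cut /= auu' /= => /negbFE/orP[]/andP[_ /eqP->].
  by rewrite side_refl orbT.
by rewrite side_refl.
Qed.

(** Links the sides of an edge with the branches at a vertex: a walk on the side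
    of [u] cannot visit [v], since [uv] is a bridge. *)
Lemma side_delete u v w : adj u v -> side u v w = connect (delete_vertex v) u w.
Proof.
move=> auv; apply/idP/idP.
  suff: side u v w -> side u v w && connect (delete_vertex v) u w.
    by move=> h /h/andP[].
  apply: (@connect_induct _ _ (fun z => side u v z && connect (delete_vertex v) u z))
    => [|x y /andP[ux cx] cxy]; first by rewrite side_refl /= connect0.
  have uy := side_step cxy ux; rewrite uy /=; apply: connect_trans cx (connect1 _).
  rewrite /delete_vertex /= (cut_adj cxy) /=; have := side_far auv => far.
  by apply/andP; split; apply: contraFneq far => e; rewrite -{2}e.
apply: connect_sub => x y /and3P[axy xv yv]; apply: connect1.
exact: cut_intro.
Qed.

Lemma side_ex v w : w != v -> exists2 u, adj v u & side u v w.
Proof.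
move=> nwv.
suff: w = v \/ exists2 u, adj v u & side u v w by case=> // e; rewrite e eqxx in nwv.
apply: (@connect_induct _ _ (fun z => z = v \/ exists2 u, adj v u & side u v z) _ _ _ _ (cT v w))
    => [|x y IH axy]; first by left.
have [->|nyv] := eqVneq y v; first by left.
right; case: IH => [e|[u avu uvx]]; first by exists y; rewrite -?e // side_refl.
have [e|nxv] := eqVneq x v; first by exists y; rewrite -?e // side_refl.
by exists u => //; apply: side_step uvx; apply: cut_intro.
Qed.

(** If [w] could be reached from [v] both through [u] and through [u'], then
    going through [u'] and [w] would be a detour around the bridge [uv]. *)
Lemma side_uniq v u u' w :
  adj v u -> adj v u' -> side u v w -> side u' v w -> u = u'.
Proof.
move=> avu avu' uw; rewrite side_delete 1?sT // => u'w.
apply/eqP; apply: contraT => nuu'.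
have auv : adj u v by rewrite sT.
case/negP: (negbT (side_far auv)); apply: connect_trans uw _.
rewrite (sym_connect_sym (@cut_sym u v)).
apply: (@connect_trans _ _ u').
  apply: connect1; rewrite /cut /= avu' eq_sym [u' == u]eq_sym.
  by rewrite (negPf nuu') (negPf (adj_neq auv)) andbF.
apply: connect_sub u'w => x y /and3P[axy xv yv]; apply: connect1; exact: cut_intro.
Qed.

Lemma side_nbr v u u' : adj v u -> adj v u' -> side u v u' = (u == u').
Proof.
move=> avu avu'; apply/idP/eqP => [h|<-]; last exact: side_refl.
exact: (@side_uniq v u u' u') (side_refl _ _).
Qed.

Lemma side_sub x y r w : adj x y -> adj y r -> r != x -> side r y w -> side y x w.
Proof.
move=> axy ayr nrx rw; rewrite side_neg //; apply: contra nrx => xw.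
by apply/eqP; apply: side_uniq rw xw; rewrite // sT.
Qed.

Lemma side_next x y w :
  adj x y -> side y x w -> w != y -> exists r, [/\ adj y r, r != x & side r y w].
Proof.
move=> axy yw /side_ex[r ayr rw]; exists r; split=> //.
by apply: contraTneq yw => e; rewrite side_neg // negbK -e.
Qed.

Lemma no_triangle x y z : adj x y -> adj y z -> adj x z -> False.
Proof.
move=> axy ayz axz.
have : side y x z.
  apply: (@side_step _ _ y); last exact: side_refl.
  by rewrite cut_intro // eq_sym adj_neq.
by rewrite side_nbr // => /eqP e; move: ayz; rewrite e iT.
Qed.

Lemma branchesP v (B : {set vert T}) :
  reflect (exists2 u, adj v u & B = [set w | side u v w]) (B \in branches v).
Proof.
have dT : connect_sym (delete_vertex v).
  by apply: sym_connect_sym => a b; rewrite /delete_vertex /= sT [(a != v) && _]andbC.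
apply: (iffP imsetP) => [[x] | [u avu ->]].
  rewrite !inE => /side_ex[u avu ux] ->; exists u => //.
  apply/setP => w; rewrite !inE side_delete 1?sT //.
  by rewrite side_delete 1?sT // in ux; apply/esym/(same_connect dT).
exists u; first by rewrite !inE eq_sym adj_neq.
by apply/setP => w; rewrite !inE side_delete 1?sT.
Qed.

Lemma first_stepP v w u : first_step v w u <-> adj v u /\ side u v w.
Proof.
split=> [[p [/= /andP[avu pth] /and3P[nv _ _] <-]] | [avu]].
  split=> //; rewrite side_delete 1?sT //; apply/connectP; exists p => //.
  move: nv; rewrite !inE negb_or => /andP[nvu nvp].
  elim: p u pth nvu nvp {avu} => //= x p IHp u /andP[aux pth] nvu.
  rewrite !inE negb_or => /andP[nvx nvp].
  by rewrite /delete_vertex /= aux eq_sym nvu eq_sym nvx /= IHp.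
rewrite side_delete 1?sT // => /connectP[p0 pth0 lastp0].
case/shortenP: pth0 lastp0 => p pth up _ lastp; exists p; split=> //.
  by rewrite /= avu; apply: sub_path pth => a b /and3P[].
rewrite cons_uniq up andbT inE negb_or adj_neq //=.
elim: p u pth {up lastp avu} => //= x p IHp u /andP[/and3P[_ _ nxv] pth].
by rewrite inE negb_or eq_sym nxv (IHp x).
Qed.

End Trees.

(** * Contractions of graphs *)

Lemma connect_homo (V V' : finType) (e : rel V) (e' : rel V') (f : V -> V') x y :
  (forall u w, e u w -> connect e' (f u) (f w)) ->
  connect e x y -> connect e' (f x) (f y).
Proof.
move=> fe; apply: (@connect_induct _ _ (fun w => connect e' (f x) (f w))) => // u w xu /fe.
exact: connect_trans.
Qed.

(** Surjective, with connected fibres, and adjacency in [U] is the image of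
    adjacency in [T]: a graph-theoretic quotient, with no condition on leaves.
    Contracting edges and removing leaves are both of this kind. *)
Definition contraction (m m' : nat) (T : lgraph m) (U : lgraph m')
    (f : vert T -> vert U) : Prop :=
  [/\ forall u, exists x, f x = u,
      forall x y, f x = f y -> connect [rel a b | adj a b && (f a == f b)] x y &
      forall u w, adj u w <->
        u <> w /\ exists x y, [/\ f x = u, f y = w & adj x y]].

Section Contraction.
Variables (m m' : nat) (T : lgraph m) (U : lgraph m') (f : vert T -> vert U).
Hypothesis cf : contraction f.

Lemma contr_surj u : exists x, f x = u.
Proof. by case: cf. Qed.

Lemma contr_fiber x y :
  f x = f y -> connect [rel a b | adj a b && (f a == f b)] x y.
Proof. by case: cf => _ h _; apply: h. Qed.

Lemma contr_adj (x y : vert T) : adj x y -> f x != f y -> adj (f x) (f y).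
Proof. by case: cf => _ _ h axy /eqP nxy; apply/h; split=> //; exists x, y. Qed.

Lemma contr_lift (u w : vert U) : adj u w -> exists x y, [/\ f x = u, f y = w & adj x y].
Proof. by case: cf => _ _ h /h[]. Qed.

Lemma contr_irr : irreflexive (@adj m' U).
Proof. by case: cf => _ _ h u; apply/negP => /h[]. Qed.

Lemma contr_neq (u w : vert U) : adj u w -> u != w.
Proof. by apply: contraTneq => ->; rewrite contr_irr. Qed.

Hypothesis bT : bridged T.

Lemma fiber_cut x y u w : f x != f y -> f u = f w -> connect (cut x y) u w.
Proof.
move=> nxy /contr_fiber; apply: connect_sub => a b /andP[aab /eqP fab].
apply: connect1; rewrite /cut /= aab /=; apply: contra nxy.
by case/orP => /andP[/eqP<- /eqP<-]; rewrite fab.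
Qed.

(** A second edge of [T] over the same edge of [U] would, with paths inside the
    two fibres, be a detour around the bridge [xy]. *)
Lemma contr_lift_uniq (x y x' y' : vert T) :
  adj x y -> f x != f y -> adj x' y' -> f x' = f x -> f y' = f y ->
  x' = x /\ y' = y.
Proof.
move=> axy nxy axy' fx fy.
suff /andP[/eqP-> /eqP->] : (x' == x) && (y' == y) by [].
apply: contraT => nn; case/negP: (negbT (side_far bT axy)).
apply: connect_trans (fiber_cut nxy (esym fx)) (connect_trans _ (fiber_cut nxy fy)).
apply: connect1; rewrite /cut /= axy' /= negb_or nn /=.
by apply: contra nxy => /andP[/eqP xx /eqP yy]; rewrite -fx xx.
Qed.

Lemma contr_cut (x y w : vert T) :
  adj x y -> f x != f y -> side x y w -> side (f x) (f y) (f w).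
Proof.
move=> axy nxy; rewrite /side; apply: (@connect_homo _ _ _ _ f) => a b cab.
have [->|nab] := eqVneq (f a) (f b); first exact: connect0.
apply: connect1; rewrite /cut /= (contr_adj (cut_adj cab)) //=.
case/andP: (cab) => aab; apply: contra => /orP[]/andP[/eqP fx /eqP fy].
  by have [-> ->] := contr_lift_uniq axy nxy aab fx fy; rewrite !eqxx.
have sT : symmetric (@adj m T) by case: bT.
rewrite sT in aab.
by have [-> ->] := contr_lift_uniq axy nxy aab fy fx; rewrite !eqxx orbT.
Qed.

(** Paths of [U] lift to [T], because edges lift and fibres are connected; the
    lift of a path that avoids an edge avoids its unique lift. *)
Lemma contr_bridged : bridged U.
Proof.
have [sT iT cT _] := bT; split.
- have h (u w : vert U) : adj u w -> adj w u.
    move=> auw; have [x [y [xu yw axy]]] := contr_lift auw; rewrite -xu -yw.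
    by apply: contr_adj; rewrite 1?sT // xu yw eq_sym contr_neq.
  by move=> u w; apply/idP/idP; apply: h.
- exact: contr_irr.
- move=> u w; have [x <-] := contr_surj u; have [y <-] := contr_surj w.
  apply: (@connect_homo _ _ _ _ f) (cT x y) => a b aab.
  have [->|nab] := eqVneq (f a) (f b); first exact: connect0.
  exact: connect1 (contr_adj aab nab).
move=> u w auw; have [x [y [xu yw axy]]] := contr_lift auw.
have nxy : f x != f y by rewrite xu yw contr_neq.
rewrite -xu -yw; apply/negP => h; case/negP: (negbT (side_far bT axy)).
suff: forall w', side (f x) (f y) w' -> forall a, f a = w' -> side x y a by move/(_ _ h); apply.
move=> w'; apply: (@connect_induct _ _ (fun w => forall a, f a = w -> side x y a)).
  by move=> a fa; apply: fiber_cut.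
move=> p q IH cpq b fb; have [a [b' [fa fb' aab]]] := contr_lift (cut_adj cpq).
apply: (@connect_trans _ _ b'); last by apply: fiber_cut => //; rewrite fb.
apply: side_step (IH a fa); rewrite /cut /= aab /=.
case/andP: cpq => _; apply: contra => /orP[]/andP[/eqP e1 /eqP e2].
  by rewrite -fa -fb' e1 e2 !eqxx.
by rewrite -fa -fb' e1 e2 !eqxx orbT.
Qed.

(** This lets the conditions of slides and of labelings be moved between a tree
    and its contractions. *)
Lemma contr_side (x y w : vert T) :
  adj x y -> f x != f y -> side (f x) (f y) (f w) = side x y w.
Proof.
move=> axy nxy; apply/idP/idP; last exact: contr_cut.
have [sT _ _ _] := bT.
apply: contraTT; rewrite -side_neg // => yw.
rewrite -(side_neg contr_bridged _ (contr_adj axy nxy)).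
by apply: contr_cut; rewrite 1?sT // eq_sym.
Qed.

Lemma contr_nbr_inj (u p q : vert T) : adj u p -> adj u q -> f p = f q -> f p != f u -> p = q.
Proof.
move=> aup auq fpq npu; have [sT _ _ _] := bT.
apply/eqP; rewrite -(side_nbr bT aup auq) -contr_side 1?sT //.
by rewrite fpq side_refl.
Qed.

End Contraction.

Section Factor.
Variables (m m1 m2 : nat) (T : lgraph m) (U1 : lgraph m1) (U2 : lgraph m2).
Variables (f1 : vert T -> vert U1) (f2 : vert T -> vert U2).

(** Being a quotient, [U1] maps to every quotient of [T] with larger fibres. *)
Lemma contr_factor : contraction f1 -> contraction f2 ->
  (forall x y, f1 x = f1 y -> f2 x = f2 y) ->
  exists2 g : vert U1 -> vert U2, contraction g & forall x, g (f1 x) = f2 x.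
Proof.
move=> c1 c2 k12; have [h hK] := fin_all_exists (contr_surj c1).
have gE x : f2 (h (f1 x)) = f2 x by apply: k12; rewrite hK.
exists (f2 \o h) => //; split=> /=.
- by move=> u; have [x <-] := contr_surj c2 u; exists (f1 x).
- move=> u w; rewrite -{2}(hK u) -{2}(hK w) => /(contr_fiber c2).
  apply: (@connect_homo _ _ _ _ f1) => a b /andP[aab /eqP fab].
  have [->|nab] := eqVneq (f1 a) (f1 b); first exact: connect0.
  by apply: connect1; rewrite /= !gE fab eqxx (contr_adj c1).
move=> u w; split.
  move=> auw; split; first by apply/eqP/(contr_neq c2).
  have [x [y [xu yw axy]]] := contr_lift c2 auw; exists (f1 x), (f1 y).
  rewrite !gE; split=> //; apply: (contr_adj c1) => //.
  by apply: contraTneq auw => /k12; rewrite -xu -yw => ->; rewrite (contr_irr c2).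
case=> nuw [x [y [xu yw axy]]].
have [a [b [xa yb aab]]] := contr_lift c1 axy.
rewrite -xu -yw -xa -yb !gE; apply: (contr_adj c2) => //; apply/eqP.
by rewrite -gE xa xu -[f2 b]gE yb yw.
Qed.

End Factor.

Lemma contr_comp (m m1 m2 : nat) (T : lgraph m) (U1 : lgraph m1) (U2 : lgraph m2)
    (f : vert T -> vert U1) (g : vert U1 -> vert U2) :
  contraction f -> contraction g -> contraction (g \o f).
Proof.
move=> cf cg; split=> /=.
- move=> u; have [w <-] := contr_surj cg u; have [x <-] := contr_surj cf w.
  by exists x.
- move=> x y /(contr_fiber cg).
  set e := (X in connect X (f x)) => cxy.
  suff: forall w, connect e (f x) w -> forall y, f y = w ->
      connect [rel a b | adj a b && ((g \o f) a == (g \o f) b)] x y by apply; eauto.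
  have fib a b : f a = f b -> connect [rel a b | adj a b && ((g \o f) a == (g \o f) b)] a b.
    move=> /(contr_fiber cf); apply: connect_sub => p q /andP[apq /eqP fpq].
    by apply: connect1; rewrite /= apq fpq eqxx.
  move=> w; apply: (@connect_induct _ _ (fun w => forall y, f y = w -> connect _ x y)).
    by move=> b /esym/fib.
  move=> u w' IH /andP[auw guw] b fb; have [p [q [fp fq apq]]] := contr_lift cf auw.
  apply: connect_trans (IH p fp) (connect_trans _ (fib q b _)); last by rewrite fq fb.
  by apply: connect1; rewrite /= apq fp fq.
move=> u w; split.
  move=> auw; split; first by apply/eqP/(contr_neq cg).
  have [p [q [gp gq apq]]] := contr_lift cg auw.
  have [x [y [fx fy axy]]] := contr_lift cf apq.
  by exists x, y; rewrite fx fy.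
case=> nuw [x [y [xu yw axy]]]; rewrite -xu -yw; apply: (contr_adj cg).
  by apply: (contr_adj cf) => //; apply/eqP => e; apply: nuw; rewrite -xu -yw e.
by apply/eqP; rewrite xu yw.
Qed.

Lemma contr_iso (m : nat) (T U : lgraph m) (f : vert T -> vert U) :
  irreflexive (@adj m T) ->
  contraction f -> injective f -> (forall l, f (leaf T l) = leaf U l) -> iso T U.
Proof.
move=> iT cf inj_f fl; exists f; split=> //.
  have [h hK] := fin_all_exists (contr_surj cf).
  by exists h => // x; apply: inj_f.
move=> x y; apply/idP/idP.
  by case/(contr_lift cf) => a [b [/inj_f-> /inj_f->]].
move=> axy; apply: (contr_adj cf) => //; apply: contraTneq axy => /inj_f ->.
by rewrite iT.
Qed.

Lemma iso_contr (m : nat) (T U : lgraph m) : irreflexive (@adj m T) -> iso T U ->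
  exists f : vert T -> vert U,
    [/\ contraction f, bijective f & forall l, f (leaf T l) = leaf U l].
Proof.
move=> iT [f [bf af fl]]; exists f; split=> //; have [h fK hK] := bf.
split.
- by move=> u; exists (h u).
- by move=> x y /(bij_inj bf) ->; apply: connect0.
move=> u w; split.
  move=> auw; split; last by exists (h u), (h w); rewrite !hK -af !hK.
  by move=> e; move: auw; rewrite e -(hK w) af iT.
by case=> _ [x [y [<- <- axy]]]; rewrite af.
Qed.

Lemma iso_sym (m : nat) (T U : lgraph m) : iso T U -> iso U T.
Proof.
case=> f [[g fK gK] fadj fl]; exists g; split; first by exists f.
  by move=> x y; rewrite -fadj !gK.
by move=> l; rewrite -fl fK.
Qed.

Lemma iso_trans (m : nat) (T U V : lgraph m) : iso T U -> iso U V -> iso T V.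
Proof.
case=> f [bf fadj fl] [g [bg gadj gl]]; exists (g \o f); split=> /=.
- exact: bij_comp.
- by move=> x y; rewrite gadj fadj.
- by move=> l; rewrite fl gl.
Qed.

(** A contraction is determined by its fibres. All comparisons below of trees
    obtained by different sequences of contractions reduce to this. *)
Lemma iso_of_kernel (m m' : nat) (T : lgraph m) (U1 U2 : lgraph m')
    (f1 : vert T -> vert U1) (f2 : vert T -> vert U2) (iota : 'I_m' -> 'I_m) :
  contraction f1 -> contraction f2 ->
  (forall x y, f1 x = f1 y <-> f2 x = f2 y) ->
  (forall l, leaf U1 l = f1 (leaf T (iota l))) ->
  (forall l, leaf U2 l = f2 (leaf T (iota l))) -> iso U1 U2.
Proof.
move=> c1 c2 k12 l1 l2.
have [g cg gE] := contr_factor c1 c2 (fun x y => proj1 (k12 x y)).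
apply: (contr_iso (contr_irr c1) cg) => [u w|l]; last by rewrite l1 gE l2.
have [x <-] := contr_surj c1 u; have [y <-] := contr_surj c1 w.
by rewrite !gE => /k12.
Qed.

Section Quotient.
Variables (m m' : nat) (T : lgraph m) (R : rel (vert T)) (iota : 'I_m' -> 'I_m).

Definition link_class (x : vert T) : {set vert T} := [set y | connect R x y].

(** The construction of [contracted], for an arbitrary set of edges and with a
    choice of the leaves to keep. *)
Definition quotient : lgraph m' :=
  {| vert := {B : {set vert T} | B \in codom link_class} : finType;
     adj := fun B C =>
       (B != C) && [exists x in val B, exists y in val C, adj x y];
     leaf := fun l =>
       exist (fun B => B \in codom link_class)
             (link_class (leaf T (iota l)))
             (codom_f link_class (leaf T (iota l))) |}.

Definition quot_map (x : vert T) : vert quotient :=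
  exist (fun B => B \in codom link_class) (link_class x) (codom_f link_class x).

Hypotheses (sR : symmetric R) (Radj : subrel R (@adj m T)).

Lemma quot_mapE x y : quot_map x = quot_map y <-> connect R x y.
Proof.
split=> [[/setP/(_ y)]|cxy]; first by rewrite !inE connect0 => ->.
apply: val_inj => /=; apply/setP => w; rewrite !inE.
exact: (same_connect (sym_connect_sym sR)).
Qed.

Lemma mem_quot (u : vert quotient) x : (x \in val u) = (quot_map x == u).
Proof.
have /codomP[y uE] := valP u; have -> : u = quot_map y by apply: val_inj.
rewrite inE (sym_connect_sym sR).
by apply/idP/eqP => /quot_mapE.
Qed.

Lemma quot_contr : contraction quot_map.
Proof.
split.
- move=> u; have /codomP[y uE] := valP u; exists y.
  by apply: val_inj.
- move=> x y /quot_mapE; apply: connect_sub => a b Rab; apply: connect1.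
  by rewrite /= Radj //=; apply/eqP/quot_mapE/connect1.
move=> u w; split.
  case/andP=> /eqP nuw /exists_inP[x xu /exists_inP[y yw axy]]; split=> //.
  by exists x, y; move: xu yw; rewrite !mem_quot => /eqP-> /eqP->.
case=> /eqP nuw [x [y [xu yw axy]]]; rewrite /adj /= nuw /=.
apply/exists_inP; exists x; first by rewrite mem_quot xu.
by apply/exists_inP; exists y => //; rewrite mem_quot yw.
Qed.

End Quotient.

Definition edge_contraction (m : nat) (U U' : lgraph m) (g : vert U -> vert U')
    (x y : vert U) : Prop :=
  [/\ contraction g, forall l, leaf U' l = g (leaf U l), adj x y, g x = g y &
      forall u w, g u = g w -> [\/ u = w, u = x /\ w = y | u = y /\ w = x]].

(** * Stable trees and the contraction of one edge *)

Section Stable.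
Variables (m : nat) (U : lgraph m).
Implicit Types u v w x y z : vert U.

Definition inner v : bool := v \notin codom (@leaf m U).

(** Stability, with bridges in place of the absence of cycles and the degree
    condition put on the vertices that are not leaves. *)
Definition stable_tree : Prop :=
  [/\ bridged U, injective (@leaf m U), forall l, deg (leaf U l) = 1 &
      forall v, inner v -> 2 < deg v].

(** This form passes easily to contractions, since it needs no cardinality. *)
Lemma deg_gt2P v :
  2 < deg v <-> forall p q, exists r, [/\ adj v r, r != p & r != q].
Proof.
split=> [dv p q|h].
  have /subsetPn[r] : ~~ ([set w | adj v w] \subset [set p; q]).
    apply: contraL dv => /subset_leq_card; rewrite -leqNgt => h; apply: leq_trans h _.
    by rewrite cards2; case: eqP.
  by rewrite !inE negb_or => avr /andP[? ?]; exists r.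
have [r1 [a1 _ _]] := h v v; have [r2 [a2 n21 _]] := h r1 r1.
have [r3 [a3 n31 n32]] := h r1 r2.
apply/card_gt2P; exists r1, r2, r3; rewrite !inE a1 a2 a3.
by split; split=> //; rewrite eq_sym.
Qed.

Lemma inner_leaf l : inner (leaf U l) = false.
Proof. by rewrite /inner codom_f. Qed.

Lemma innerPn v : ~~ inner v -> exists l, v = leaf U l.
Proof. by move/negbNE/codomP. Qed.

Lemma inner_neq v l : inner v -> v != leaf U l.
Proof. by apply: contraTneq => ->; rewrite inner_leaf. Qed.

Lemma stable_stable_tree : stable U -> stable_tree.
Proof.
case=> [[/tree_bridged bU inj_l leaf1] deg2 [v0 dv0]]; split=> // [l|v iv].
  by apply/eqP; rewrite leaf1 codom_f.
have d1 : deg v != 1 by rewrite leaf1.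
suff: deg v != 0 by move: (deg2 v) d1; case: (deg v) => [|[|[|]]].
have [<-|nv0] := eqVneq v0 v; first by case: (deg v0) dv0.
have [u avu _] := side_ex bU nv0; rewrite -lt0n; apply/card_gt0P.
by exists u; rewrite inE.
Qed.

Hypothesis sU : stable_tree.

Let bU : bridged U. Proof. by case: sU. Qed.
Let symU : symmetric (@adj m U). Proof. by case: bU. Qed.

Lemma leaf_inj : injective (@leaf m U). Proof. by case: sU. Qed.

Lemma leaf_nbr l : exists2 z, adj (leaf U l) z & forall w, adj (leaf U l) w -> w = z.
Proof.
have /eqP/cards1P[z zE] : deg (leaf U l) = 1 by case: sU.
have nE w : adj (leaf U l) w = (w == z) by have /setP/(_ w) := zE; rewrite !inE.
by exists z => [|w]; rewrite nE // => /eqP.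
Qed.

Lemma leaf_adj_uniq l x y : adj (leaf U l) x -> adj (leaf U l) y -> x = y.
Proof. by have [z _ h] := leaf_nbr l => /h-> /h->. Qed.

Lemma leaf_side l y w : adj (leaf U l) y -> side (leaf U l) y w -> w = leaf U l.
Proof.
move=> aly lw; apply/eqP; apply: contraT => nwl.
have ayl : adj y (leaf U l) by rewrite symU.
have [r [alr nry _]] := side_next bU ayl lw nwl.
by rewrite (leaf_adj_uniq alr aly) eqxx in nry.
Qed.

Lemma inner_nbr v p q : inner v -> exists r, [/\ adj v r, r != p & r != q].
Proof. by move=> iv; have [_ _ _ /(_ v iv)/deg_gt2P] := sU. Qed.

Lemma two_nbrs_inner v p q : adj v p -> adj v q -> p != q -> inner v.
Proof.
move=> avp avq npq; apply: contraT => /negbNE/codomP[l vE].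
by move: npq; rewrite (@leaf_adj_uniq l p q) -?vE // eqxx.
Qed.

Lemma side_leaf x y : adj x y -> exists l, side x y (leaf U l).
Proof.
have [k] := ubnP #|[set w | side x y w]|; elim: k x y => // k IHk x y.
rewrite ltnS => card_k axy.
have [ix|/innerPn[l ->]] := boolP (inner x); last by exists l; apply: side_refl.
have [r [axr nry _]] := inner_nbr y y ix; have ayx : adj y x by rewrite symU.
have sub w : side r x w -> side x y w by apply: side_sub.
have arx : adj r x by rewrite symU.
have [|l rl] := IHk r x _ arx; last by exists l; apply: sub.
apply: leq_trans card_k; apply: proper_card; apply/properP; split.
  by apply/subsetP => w; rewrite !inE; apply: sub.
by exists x; rewrite !inE ?side_refl // side_far.
Qed.

End Stable.

Section Stable3.
Variables (m : nat) (U : lgraph m.+3).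
Implicit Types u v w x y z : vert U.

Lemma third_label (l l' : 'I_m.+3) : exists l'', l'' != l /\ l'' != l'.
Proof.
have /subsetPn[l'' _] : ~~ ([set: 'I_m.+3] \subset [set l; l']).
  apply/negP => /subset_leq_card; rewrite cardsT card_ord cards2.
  by case: eqP.
by rewrite !inE negb_or => /andP[? ?]; exists l''.
Qed.

Hypothesis sU : stable_tree U.

Let bU : bridged U. Proof. by case: sU. Qed.
Let symU : symmetric (@adj m.+3 U). Proof. by case: bU. Qed.

(** Two adjacent leaves would be the whole tree, and there are at least three
    labels. *)
Lemma leaf_nbr_inner l x : adj (leaf U l) x -> inner x.
Proof.
move=> alx; apply: contraT => /negbNE/codomP[l' xE]; rewrite {}xE in alx.
have [l'' [n1 n2]] := third_label l l'.
have : side (leaf U l) (leaf U l') (leaf U l'') || side (leaf U l') (leaf U l) (leaf U l'').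
  by rewrite (side_neg bU _ alx); case: side.
case/orP => /(leaf_side sU) e.
  by have /(leaf_inj sU) ee := e alx; rewrite ee eqxx in n1.
by rewrite symU in alx; have /(leaf_inj sU) ee := e alx; rewrite ee eqxx in n2.
Qed.

Lemma stable_tree_stable : stable U.
Proof.
have [_ inj_l leaf1 inner3] := sU.
have dE v : (deg v == 1) = (v \in codom (leaf U)).
  apply/eqP/idP => [dv|/codomP[l ->] //].
  by apply: contraT => /inner3; rewrite dv.
split; first by split=> //; apply: bridged_tree.
  move=> v; have [/inner3|/innerPn[l ->]] := boolP (inner v); last by rewrite leaf1.
  by case: (deg v) => [|[|[|]]].
have [z alz _] := leaf_nbr sU ord0; exists z.
exact: inner3 (leaf_nbr_inner alz).
Qed.

End Stable3.

Section ContrStable.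
Variables (m m' : nat) (T : lgraph m) (U : lgraph m') (f : vert T -> vert U).
Hypotheses (cf : contraction f) (bT : bridged T).

(** When nothing is merged with [u], the contraction is injective on the
    neighbours of [u]: two of them in one fibre would close a cycle through
    [u]. *)
Lemma contr_deg u : (forall w, f w = f u -> w = u) -> deg (f u) = deg u.
Proof.
move=> fu; rewrite /deg -(@card_in_imset _ _ f [set w | adj u w]).
  apply: eq_card => w; rewrite inE; apply/idP/imsetP.
    by case/(contr_lift cf) => x [y [/fu-> <- auy]]; exists y; rewrite ?inE.
  case=> x; rewrite inE => aux ->; apply: (contr_adj cf) => //.
  apply: contraTneq aux => /esym/fu ->.
  by have [_ -> _ _] := bT.
move=> p q; rewrite !inE => aup auq fpq.
apply: (contr_nbr_inj cf bT aup auq fpq); apply: contraTneq aup => /fu ->.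
by have [_ -> _ _] := bT.
Qed.

End ContrStable.

Section EdgeContraction.
Variables (m : nat) (U U' : lgraph m) (g : vert U -> vert U') (x y : vert U).
Hypotheses (sU : stable_tree U) (eg : edge_contraction g x y).

Let bU : bridged U. Proof. by case: sU. Qed.
Let symU : symmetric (@adj m U). Proof. by case: bU. Qed.

Lemma ec_single u : u != x -> u != y -> forall w, g w = g u -> w = u.
Proof.
move=> nux nuy w; have [_ _ _ _ kg] := eg.
by case/kg => // -[_ e]; move: nux nuy; rewrite e eqxx.
Qed.

Lemma ec_card : #|vert U'|.+1 = #|vert U|.
Proof.
have [cg _ axy gxy kg] := eg.
have yU : 0 < #|vert U| by apply/card_gt0P; exists y.
rewrite -(prednK yU) -(cardsC1 y); congr _.+1.
have <- : #|g @: [set~ y]| = #|vert U'|.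
  apply: eq_card => u; rewrite [RHS]inE; apply/imsetP.
  have [w <-] := contr_surj cg u; have [->|nwy] := eqVneq w y; last by exists w; rewrite ?inE.
  by exists x => //; rewrite !inE (adj_neq bU).
apply: card_in_imset => u w; rewrite !inE => nu nw /kg[] // [e1 e2].
  by rewrite e2 eqxx in nw.
by rewrite e1 eqxx in nu.
Qed.

Hypotheses (ix : inner x) (iy : inner y).

Lemma ec_inner u : inner (g u) = inner u.
Proof.
have [cg gl axy gxy kg] := eg.
apply/idP/idP; apply: contraTT => /negbNE/codomP[l].
  by move=> ->; rewrite -gl inner_leaf.
rewrite gl => /kg[->|[_ e]|[_ e]]; first by rewrite inner_leaf.
  by move: iy; rewrite -e inner_leaf.
by move: ix; rewrite -e inner_leaf.
Qed.

(** The merged vertex keeps two neighbours of [x] and one of [y], which are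
    distinct since a tree has no triangle. *)
Lemma ec_stable : stable_tree U'.
Proof.
have [cg gl axy gxy kg] := eg; have [_ inj_l leaf1 inner3] := sU.
have lx l : leaf U l != x by rewrite eq_sym inner_neq.
have ly l : leaf U l != y by rewrite eq_sym inner_neq.
split.
- exact: contr_bridged cg bU.
- by move=> l l'; rewrite !gl => /(ec_single (lx l') (ly l'))/inj_l.
- by move=> l; rewrite gl (contr_deg cg bU) //; apply: ec_single.
move=> v; have [u <-] := contr_surj cg v; rewrite ec_inner => iu.
have [uxy|] := boolP ((u == x) || (u == y)); last first.
  by rewrite negb_or => /andP[nux nuy]; rewrite (contr_deg cg bU) ?inner3 //; apply: ec_single.
have -> : g u = g x by case/orP: uxy => /eqP->.
have [p [axp npy _]] := inner_nbr sU y y ix.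
have [q [axq nqy nqp]] := inner_nbr sU y p ix.
have [s [ays nsx _]] := inner_nbr sU x x iy.
have npx : p != x by rewrite eq_sym (adj_neq bU).
have nqx : q != x by rewrite eq_sym (adj_neq bU).
have nsy : s != y by rewrite eq_sym (adj_neq bU).
have nps : p != s by apply: contraTneq axp => ->; apply/negP; apply: no_triangle axy ays.
have nqs : q != s by apply: contraTneq axq => ->; apply/negP; apply: no_triangle axy ays.
have gx w : w != x -> w != y -> g x != g w.
  by move=> n1 n2; apply/eqP => /(ec_single n1 n2) e; rewrite e eqxx in n1.
apply/card_gt2P; exists (g p), (g q), (g s); rewrite !inE; split; split.
- by rewrite (contr_adj cg) ?gx.
- by rewrite (contr_adj cg) ?gx.
- by rewrite gxy (contr_adj cg) -?gxy ?gx.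
- by apply: contraNneq nqp => /(ec_single nqx nqy) ->.
- by apply: contraNneq nqs => /(ec_single nsx nsy) ->.
- by apply: contraNneq nps => /(ec_single npx npy) ->.
Qed.

End EdgeContraction.

(** * Undoing a slide *)

Lemma is_min_ext (m : nat) (P Q : 'I_m -> Prop) l :
  (forall l', P l' <-> Q l') -> is_min P l -> is_min Q l.
Proof. by move=> PQ [/PQ Ql h]; split=> // l' /PQ/h. Qed.

Lemma ex_is_min (m : nat) (P : pred 'I_m) l0 : P l0 -> exists l, is_min P l.
Proof.
by move=> Pl0; case: (arg_minnP (@nat_of_ord m) Pl0) => l Pl h; exists l; split.
Qed.

Lemma side_other (m : nat) (T : lgraph m) (x y z : vert T) :
  bridged T -> adj x y -> adj x z -> z != y -> side x y z.
Proof.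
move=> bT axy axz nzy; apply: side_step (side_refl x y).
by rewrite cut_intro // (adj_neq bT).
Qed.

(** The tree [U] arises from contracting [xy] by an [i]-slide whose new vertex
    is [y]; [r] is the vertex after [y] on the path to [a], and [my] is the
    smallest label moved with the new vertex. The conditions involve only sides of
    the edges [xy] and [yr]. *)
Definition unslide (m : nat) (U : lgraph m.+3) (i : 'I_m.+3) (x y r : vert U)
    (mx my : 'I_m.+3) : Prop :=
  [/\ adj (leaf U i) x, adj x y,
      [/\ adj y r, r != x & side r y (leaf U label_a)],
      is_min (fun l => (l != i) && side x y (leaf U l)) mx &
      is_min (fun l => side y x (leaf U l) && ~~ side r y (leaf U l)) my
      /\ my < mx].

Section Transfer.
Variables (m m' : nat) (W : lgraph m.+3) (U : lgraph m'.+3).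
Variables (f : vert W -> vert U) (iota : 'I_m'.+3 -> 'I_m.+3).
Hypotheses (cf : contraction f) (bW : bridged W).
Hypothesis iotaE : forall l, iota l = l :> nat.
Hypothesis fl : forall l, leaf U l = f (leaf W (iota l)).

Lemma iota_inj : injective iota.
Proof. by move=> l l' e; apply: val_inj; rewrite /= -iotaE e iotaE. Qed.

Lemma is_min_iota (P : pred 'I_m.+3) l :
  is_min P (iota l) <-> is_min (fun l' => P (iota l')) l.
Proof.
split=> [[Pl h]|[Pl h]]; split=> // l' Pl'; first by rewrite -iotaE -[l' : nat]iotaE h.
rewrite iotaE; have [lt|ge] := ltnP l' m'.+3.
  have e : iota (Ordinal lt) = l' by apply: val_inj; rewrite /= iotaE.
  by rewrite -[l' : nat]/(Ordinal lt : nat); apply: h; rewrite e.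
by apply: leq_trans ge; apply: ltnW.
Qed.

(** All conditions of [unslide] are about sides of edges that [f] does not
    collapse. The labels outside the image of [iota] exceed all others, so
    they do not affect the minima. *)
Lemma unslide_transfer i x y r mx my :
  adj (leaf W (iota i)) x -> adj x y -> adj y r ->
  f (leaf W (iota i)) != f x -> f x != f y -> f y != f r ->
  unslide i (f x) (f y) (f r) mx my <->
  unslide (iota i) x y r (iota mx) (iota my).
Proof.
move=> aix axy ayr nix nxy nyr.
have [symW _ _ _] := bW; have ary : adj r y by rewrite symW.
have ayx : adj y x by rewrite symW.
have nry : f r != f y by rewrite eq_sym.
have nyx : f y != f x by rewrite eq_sym.
have la : iota label_a = label_a by apply: val_inj; rewrite /= iotaE.
have sxy w : side (f x) (f y) (f w) = side x y w by apply: contr_side.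
have syx w : side (f y) (f x) (f w) = side y x w by apply: contr_side.
have sry w : side (f r) (f y) (f w) = side r y w by apply: contr_side.
have rx : (f r != f x) = (r != x).
  congr (~~ _); apply/eqP/eqP => [e|-> //].
  exact: (contr_nbr_inj cf bW ayr ayx).
pose Px l := (l != iota i) && side x y (leaf W l).
pose Py l := side y x (leaf W l) && ~~ side r y (leaf W l).
have Pxy l : Px (iota l) = (l != i) && side (f x) (f y) (leaf U l).
  by rewrite /Px fl sxy (inj_eq iota_inj).
have Pyx l : Py (iota l) = side (f y) (f x) (leaf U l) && ~~ side (f r) (f y) (leaf U l).
  by rewrite /Py fl syx sry.
split=> [[_ _ [_ n1 sa] minx [miny lt]]|[_ _ [_ n1 sa] minx [miny lt]]].
  split=> //.
  - by split=> //; [rewrite -rx | rewrite -la -sry -fl].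
  - by apply/(@is_min_iota Px); apply: is_min_ext minx => l; rewrite Pxy.
  split; last by rewrite !iotaE.
  by apply/(@is_min_iota Py); apply: is_min_ext miny => l; rewrite Pyx.
split.
- by rewrite fl (contr_adj cf).
- exact: (contr_adj cf).
- by split=> //; [apply: (contr_adj cf) | rewrite rx | rewrite fl la sry].
- by move/(@is_min_iota Px): minx; apply: is_min_ext => l; rewrite Pxy.
split; last by move: lt; rewrite !iotaE.
by move/(@is_min_iota Py): miny; apply: is_min_ext => l; rewrite Pyx.
Qed.

End Transfer.

Section UnslideFacts.
Variables (m : nat) (U : lgraph m.+3) (i : 'I_m.+3) (x y r : vert U) (mx my : 'I_m.+3).
Hypotheses (sU : stable_tree U) (us : unslide i x y r mx my).

Lemma unslide_inner : inner x /\ inner y.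
Proof.
have [aix axy [ayr nrx _] _ _] := us; have [[symU _ _ _] _ _ _] := sU.
split; first exact: leaf_nbr_inner aix.
by apply: (two_nbrs_inner sU ayr _ nrx); rewrite symU.
Qed.

Lemma unslide_side_i : side x y (leaf U i).
Proof.
have [aix axy [ayr nrx _] _ _] := us; have [bU _ _ _] := sU.
have [symU _ _ _] := bU; have [_ iy] := unslide_inner.
by apply: side_other => //; rewrite 1?symU // eq_sym inner_neq.
Qed.

End UnslideFacts.

Lemma bij_stable_tree (m : nat) (T U : lgraph m) :
  iso T U -> stable_tree T -> stable_tree U.
Proof.
move=> isoTU [bT inj_l leaf1 inner3].
have [|f [cf bf fl]] := iso_contr _ isoTU; first by case: bT.
have fdeg u : deg (f u) = deg u by apply: contr_deg => // w /(bij_inj bf).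
split.
- exact: contr_bridged cf bT.
- by move=> l l'; rewrite -!fl => /(bij_inj bf)/inj_l.
- by move=> l; rewrite -fl fdeg.
move=> v; have [u <-] := contr_surj cf v => iv; rewrite fdeg inner3 //.
by apply: contraNN iv => /codomP[l ->]; rewrite fl codom_f.
Qed.

Section SlideUnslide.
Variables (n : nat) (i : 'I_n.+3).

Section OnSlid.
Variables (T : lgraph n.+3) (z : vert T) (W : {set vert T}).
Hypothesis bT : bridged T.

Let S := slid_graph z W.
Let g (u : vert S) : vert T := odflt z u.

(** Sending the new vertex back to [z] undoes the slide. *)
Lemma slid_contraction : edge_contraction (g : vert S -> vert T) (Some z) None.
Proof.
have [symT irrT _ _] := bT.
have fib (u w : vert S) : g u = g w ->
  [\/ u = w, u = Some z /\ w = None | u = None /\ w = Some z].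
  case: u w => [u|] [w|]; rewrite /g /=.
  - by move=> ->; constructor 1.
  - by move=> ->; constructor 2.
  - by move=> ->; constructor 3.
  - by constructor 1.
have azN : @adj _ S (Some z) None by rewrite /= eqxx.
split=> //; split.
- by move=> u; exists (Some u).
- move=> u w /fib[->|[-> ->]|[-> ->]]; first exact: connect0.
    by apply: connect1; rewrite /= /g /= !eqxx.
  by apply: connect1; rewrite /= /g /= !eqxx.
move=> u w; split.
  move=> auw; split; first by move=> e; rewrite e irrT in auw.
  have [uz|nuz] := eqVneq u z.
    have [wW|nwW] := boolP (w \in W).
      by exists None, (Some w); rewrite /= /g /= -uz auw wW orbT.
    exists (Some u), (Some w); split=> //=; rewrite auw (negPf nwW) andbF /=.
    suff -> : (w == z) = false by [].
    by apply/eqP => e; move: auw; rewrite e uz irrT.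
  have [wz|nwz] := eqVneq w z.
    have [uW|nuW] := boolP (u \in W).
      exists (Some u), None; rewrite /= /g /= -wz symT auw uW orbT.
      by [].
    by exists (Some u), (Some w); split=> //=; rewrite auw (negPf nuW) andbF (negPf nuz).
  by exists (Some u), (Some w); split=> //=; rewrite auw (negPf nuz) (negPf nwz).
case=> nuw [[x|] [[y|] []]]; rewrite /g /= => xu yw; rewrite -xu -yw.
- by case/andP.
- case/orP => [/eqP e|/andP[]]; last by rewrite symT.
  by case: nuw; rewrite -xu -yw e.
- case/orP => [/eqP e|/andP[]] //.
  by case: nuw; rewrite -xu -yw e.
by [].
Qed.

End OnSlid.

Lemma edge_contraction_iso (U S U' : lgraph n.+3) (k : vert U -> vert S) h
    (g : vert S -> vert U') x y :
  irreflexive (@adj n.+3 U) ->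
  contraction k -> cancel k h -> cancel h k -> (forall l, k (leaf U l) = leaf S l) ->
  edge_contraction g x y -> edge_contraction (g \o k) (h x) (h y).
Proof.
move=> iU ck kK hK kl [cg gl axy gxy kg]; split=> /=.
- exact: contr_comp.
- by move=> l; rewrite gl kl.
- have [a [b [<- <- aab]]] := contr_lift ck axy; by rewrite !kK.
- by rewrite !hK.
move=> u w /kg[/(can_inj kK)->|[<- <-]|[<- <-]]; rewrite ?kK.
- by constructor 1.
- by constructor 2.
by constructor 3.
Qed.

(** The branches at the new vertex, other than those of [a] and [i], are the
    moved ones, so the label [l] of the definition of slides is their minimum;
    what stays at the old vertex has larger labels because [l] is also minimal
    among all labels outside the branch of [a]. *)
Lemma slide_unslide (T U : lgraph n.+3) :
  i != label_a -> stable_tree T -> slide i T U ->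
  exists g x y r mx my,
    @edge_contraction _ U T g x y /\ unslide i x y r mx my.
Proof.
move=> nia sT [z [Bra [Brm [l [M [aiz [Ba aBa] minl [Bm lBm] [subM BmM isoSU stU]]]]]]].
have sU := stable_stable_tree stU.
have [bT _ _ _] := sT; have [symT irrT _ _] := bT.
set W := Bra :|: cover M in isoSU; set S := slid_graph z W in isoSU.
have sS : stable_tree S by apply: bij_stable_tree (iso_sym isoSU) sU.
have [bS _ _ _] := sS; have [symS irrS _ _] := bS.
have ecS := slid_contraction z W bT; have [cg gl aSzN gzN kg] := ecS.
set g := (fun u : option (vert T) => odflt z u) in cg gl gzN kg ecS.
have /(branchesP bT)[rho azr BraE] := Ba.
have /(branchesP bT)[mu azmu BrmE] := Bm.
have azi : adj z (leaf T i) by rewrite symT.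
have rW : rho \in W by rewrite !inE BraE inE side_refl.
have muW : mu \in W.
  rewrite !inE; apply/orP; right; apply/bigcupP; exists Brm => //.
  by rewrite BrmE inE side_refl.
have niW : leaf T i \notin W.
  rewrite !inE negb_or BraE inE; apply/andP; split.
    rewrite (side_nbr bT) //; apply: contraNneq nia => e; apply/eqP/(leaf_inj sT).
    by move: aBa; rewrite BraE inE e => /(leaf_side sT); rewrite symT => /(_ azi).
  apply/bigcupP => -[B BM iB].
  have := subsetP subM B BM; rewrite !inE negb_or => /andP[/andP[_ /eqP nBi]].
  case/(branchesP bT) => p azp BE; move: iB; rewrite BE inE (side_nbr bT) // => /eqP pE.
  apply: nBi; rewrite BE pE; apply/setP => w; rewrite !inE.
  by apply/idP/eqP => [/(leaf_side sT)->|-> //]; rewrite ?side_refl // symT.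
have nmr : mu != rho.
  apply: contraTneq lBm => e; rewrite BrmE e -BraE.
  by case: minl => -[].
have nzW p : p \in W -> adj z p -> @adj _ S None (Some p).
  by move=> pW azp; rewrite /= azp pW orbT.
have aNr : @adj _ S None (Some rho) by apply: nzW.
have aNmu : @adj _ S None (Some mu) by apply: nzW.
have aiS : @adj _ S (leaf S i) (Some z).
  rewrite /= aiz (negPf niW) andbF /= andbT.
  by rewrite negb_and (adj_neq bT).
have aSzi : @adj _ S (Some z) (leaf S i) by rewrite symS.
have aNz : @adj _ S None (Some z) by rewrite symS.
have nz p : adj z p -> z != p by apply: adj_neq.
have srho w : side (Some rho : vert S) None (Some w) = side rho z w.
  have nrz : g (Some rho) != g None by rewrite /= eq_sym nz.
  have arN : @adj _ S (Some rho) None by rewrite symS.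
  exact: (esym (contr_side cg bS (Some w) arN nrz)).
have smu w : side (Some mu : vert S) None (Some w) = side mu z w.
  have nrz : g (Some mu) != g None by rewrite /= eq_sym nz.
  have arN : @adj _ S (Some mu) None by rewrite symS.
  exact: (esym (contr_side cg bS (Some w) arN nrz)).
(* Stability of the slid tree leaves a branch besides that of [i] at [z],
hence a smallest label there. *)
have [r' [azr' nr'i nr'N]] : exists r' : vert S,
    [/\ adj (Some z : vert S) r', r' != leaf S i & r' != None].
  by apply: (inner_nbr sS); apply: (leaf_nbr_inner sS aiS).
have ar'z : adj r' (Some z : vert S) by rewrite symS.
have [l0 r'l0] := side_leaf sS ar'z.
pose P l := (l != i) && side (Some z : vert S) None (leaf S l).
have [|mx minx] := @ex_is_min _ P l0.
  rewrite /P (side_sub bS aNz azr' nr'N r'l0) andbT.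
  by apply: contraNneq nr'i => e; move: r'l0; rewrite e (side_nbr bS azr' aSzi).
have minl' : is_min (fun l => side (None : vert S) (Some z) (leaf S l)
    && ~~ side (Some rho : vert S) None (leaf S l)) l.
  have [[nli nla] hl] := minl; split.
    apply/andP; split.
      apply: (side_sub bS aSzN aNmu); first by apply: contraTneq azmu => -[->]; rewrite irrT.
      by rewrite smu; move: lBm; rewrite BrmE inE.
    by rewrite srho; move: nla; rewrite BraE inE.
  move=> l' /andP[l'N nl'r]; apply: hl; split.
    move=> e; move: l'N; rewrite e (side_neg bS) // => /negP; apply.
    by apply: (side_other bS).
  by rewrite BraE inE -srho.
have ltm : l < mx.
  have [[nli nla] hl] := minl; have [/andP[nmi zm] hm] := minx.
  rewrite ltn_neqAle; apply/andP; split.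
    apply/negP => /eqP/val_inj e; case: minl' => /andP[+ _] _.
    by rewrite e (side_neg bS) // zm.
  apply: hl; split; first exact/eqP.
  rewrite BraE inE -srho; apply: contraTN zm => rm.
  rewrite -(side_neg bS) //; apply: (side_sub bS aSzN aNr) => //.
  by apply: contraTneq azr => -[->]; rewrite irrT.
have usS : unslide i (Some z : vert S) None (Some rho) mx l.
  split=> //; split=> //; first by apply: contraTneq azr => -[->]; rewrite irrT.
  by rewrite srho; move: aBa; rewrite BraE inE.
have [bU _ _ _] := sU; have [symU irrU _ _] := bU.
have [k [ck [h kK hK] kl]] := iso_contr irrU (iso_sym isoSU).
exists (g \o k), (h (Some z)), (h None), (h (Some rho)), mx, l; split.
  exact: (edge_contraction_iso irrU ck kK hK kl ecS).
have hadj a b : @adj _ S a b -> adj (h a) (h b).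
  by move=> aab; have [p [q [<- <- apq]]] := contr_lift ck aab; rewrite !kK.
have hi : adj (leaf U i) (h (Some z)).
  by have := hadj _ _ aiS; rewrite -kl kK.
apply/(unslide_transfer (iota := id) ck bU) => //.
- exact: hadj.
- exact: hadj.
- by rewrite hK kl (adj_neq bS).
- by rewrite !hK.
- by rewrite !hK.
by rewrite !hK.
Qed.

End SlideUnslide.

(** The moved branches are those whose root was adjacent to [y] in [U]. The
    label [my] is minimal among all labels off the branch of [a]: on the side
    of [y] by its definition, on the side of [x] because [my < mx]. *)
Lemma unslide_slide (n : nat) (i : 'I_n.+3) (T U : lgraph n.+3)
    (g : vert U -> vert T) (x y r : vert U) (mx my : 'I_n.+3) :
  stable_tree U -> edge_contraction g x y -> unslide i x y r mx my -> slide i T U.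
Proof.
move=> sU ec us; have [ix iy] := unslide_inner sU us.
have sT := ec_stable sU ec ix iy.
have [cg gl axy gxy kg] := ec.
have [aix _ [ayr nrx aa] [/andP[nmxi mxx] hmx] [[/andP[myy nmyr] hmy] ltm]] := us.
have [bU _ _ _] := sU; have [symU irrU _ _] := bU.
have [bT _ _ _] := sT; have [symT irrT _ _] := bT.
have xi := unslide_side_i sU us.
have ayx : adj y x by rewrite symU.
have sg := ec_single ec.
set z := g x.
have gneq u w : w != x -> w != y -> u != w -> g u != g w.
  by move=> nwx nwy nuw; apply/eqP => /(sg w nwx nwy) e; rewrite e eqxx in nuw.
have nbrx w : adj x w -> w != x by rewrite eq_sym; apply: adj_neq.
have nbry w : adj y w -> w != y by rewrite eq_sym; apply: adj_neq.
have sidex w u : adj x w -> w != y -> side (g w) z (g u) = side w x u.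
  move=> axw nwy; apply: (contr_side cg bU); first by rewrite symU.
  by rewrite eq_sym gneq ?nbrx // (adj_neq bU).
have sidey w u : adj y w -> w != x -> side (g w) z (g u) = side w y u.
  move=> ayw nwx; rewrite /z gxy; apply: (contr_side cg bU); first by rewrite symU.
  by rewrite eq_sym gneq ?nbry // (adj_neq bU).
have azx w : adj x w -> w != y -> adj z (g w).
  by move=> axw nwy; apply: (contr_adj cg) => //; rewrite gneq ?nbrx // (adj_neq bU).
have azy w : adj y w -> w != x -> adj z (g w).
  move=> ayw nwx; rewrite /z gxy; apply: (contr_adj cg) => //.
  by rewrite gneq ?nbry // (adj_neq bU).
have far w u : adj y w -> w != x -> side w y u -> ~~ side x y u.
  by move=> ayw nwx wu; rewrite -(side_neg bU) // (side_sub bU axy ayw).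
pose brch w : {set vert T} := [set u | side (g w) z u].
have br w : adj y w -> w != x -> brch w \in branches z.
  by move=> ayw nwx; apply/(branchesP bT); exists (g w) => //; apply: azy.
have brneq w w' : adj y w -> w != x -> adj y w' -> w' != x -> w != w' -> brch w != brch w'.
  move=> ayw nwx ayw' nwx' nww'; apply: contraNneq nww' => /setP/(_ (g w)).
  rewrite !inE side_refl sidey // => /esym.
  by rewrite (side_nbr bU ayw' ayw) => /eqP ->.
have myx : side x y (leaf U my) = false by apply: negbTE; rewrite -(side_neg bU).
have [mu [aymu nmux mumy]] : exists mu, [/\ adj y mu, mu != x & side mu y (leaf U my)].
  by apply: (side_next bU axy myy); rewrite eq_sym inner_neq.
have nmur : mu != r by apply: contraNneq nmyr => <-.
pose M := [set brch w | w in [set w | [&& adj y w, w != x & w != r]]].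
set W := brch r :|: cover M.
have memW u : reflect (exists w, [/\ adj y w, w != x & side (g w) z u]) (u \in W).
  rewrite !inE; apply: (iffP orP).
    case=> [ru|/bigcupP[B /imsetP[w]]]; first by exists r.
    by rewrite !inE => /and3P[ayw nwx _] -> uB; exists w; rewrite inE in uB.
  case=> w [ayw nwx wu]; have [e|nwr] := eqVneq w r; first by left; rewrite -e.
  right; apply/bigcupP; exists (brch w); last by rewrite inE.
  by apply/imsetP; exists w => //; rewrite !inE ayw nwx.
have Wy w : adj y w -> w != x -> g w \in W.
  by move=> ayw nwx; apply/memW; exists w; rewrite side_refl.
have Wx w : adj x w -> w != y -> g w \notin W.
  move=> axw nwy; apply/memW => -[w' [ayw' nwx' w'w]]; rewrite sidey // in w'w.
  by have /negP := far _ _ ayw' nwx' w'w; apply; apply: (side_other bU).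
have adjz w : w != x -> w != y -> adj z (g w) -> adj x w \/ adj y w.
  move=> nwx nwy /(contr_lift cg)[a [b [ga gb aab]]].
  have bw := sg w nwx nwy b gb; rewrite bw in aab.
  by case/kg: ga aab => [->|[-> _]|[-> _]]; auto.
exists z, (brch r), (brch mu), my, M; split.
- rewrite gl; apply: (contr_adj cg) => //; rewrite eq_sym gneq ?inner_neq //.
  + by rewrite eq_sym inner_neq.
  by rewrite eq_sym inner_neq.
- by split; [apply: br | rewrite inE gl sidey].
- split.
    split; first by move=> e; move: myx; rewrite e xi.
    by rewrite gl inE sidey //; apply: nmyr.
  move=> l [/eqP nli]; rewrite gl inE sidey // => nlr.
  have [xl|nxl] := boolP (side x y (leaf U l)).
    by apply: leq_trans (ltnW ltm) (hmx _ _); rewrite nli xl.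
  by apply: hmy; rewrite (side_neg bU) // nxl.
- by split; [apply: br | rewrite inE gl sidey].
split.
- apply/subsetP => B /imsetP[w]; rewrite inE => /and3P[ayw nwx nwr] ->.
  rewrite !inE negb_or brneq //= br // andbT.
  apply/eqP => /setP/(_ (leaf T i)); rewrite !inE eqxx gl sidey // => wi.
  by have := far _ _ ayw nwx wi; rewrite xi.
- by apply/imsetP; exists mu; rewrite // inE aymu nmux.
- apply: iso_sym.
  (* In [slid_graph], [None] is the new vertex, that is [y], and the old vertex
  [z] plays the part of [x]. *)
  pose k (u : vert U) : vert (slid_graph z W) := if u == y then None else Some (g u).
  have inj_k : injective k.
    move=> u w; rewrite /k; have [->|nuy] := eqVneq u y; have [->|nwy] := eqVneq w y => // -[].
    by case/kg=> // -[e1 e2]; [rewrite e2 eqxx in nwy | rewrite e1 eqxx in nuy].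
  exists k; split.
  + apply: inj_card_bij => //; rewrite -(ec_card sU ec) /= card_option.
    by [].
  + have symS (a b : vert (slid_graph z W)) : adj a b = adj b a.
      case: a b => [a|] [b|] //=; rewrite symT; congr (_ && _).
      by rewrite andbC.
    have ky w : w != y -> adj (k y) (k w) = adj y w.
      move=> nwy; rewrite /k eqxx (negPf nwy) /=.
      have [->|nwx] := eqVneq w x; first by rewrite eqxx ayx.
      have -> : (g w == z) = false by apply: negbTE; rewrite eq_sym gneq // eq_sym.
      rewrite /=; apply/andP/idP => [[azw wW]|ayw]; last by rewrite azy ?Wy.
      by case: (adjz w nwx nwy azw) => // axw; case/negP: (Wx w axw nwy).
    have kx w : w != x -> w != y -> adj (k x) (k w) = adj x w.
      move=> nwx nwy; rewrite /k (negPf nwy) (negPf (adj_neq bU axy)) /= eqxx /=.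
      have -> : (g w == z) = false by apply: negbTE; rewrite eq_sym gneq // eq_sym.
      rewrite /= andbT; apply/andP/idP => [[azw wW]|axw]; last by rewrite azx ?Wx.
      by case: (adjz w nwx nwy azw) => // ayw; rewrite Wy in wW.
    move=> u w.
    have [-> {u}|nuy] := eqVneq u y.
      have [->|nwy] := eqVneq w y; last exact: ky.
      by rewrite irrU /k eqxx.
    have [->|nwy] := eqVneq w y; first by rewrite symS ky // symU.
    have [-> {u nuy}|nux] := eqVneq u x.
      have [->|nwx] := eqVneq w x; last exact: kx.
      by rewrite irrU /k (negPf (adj_neq bU axy)) /= irrT.
    have [->|nwx] := eqVneq w x; first by rewrite symS kx // symU.
    rewrite /k (negPf nuy) (negPf nwy) /=.
    have nz v : v != x -> v != y -> (g v == z) = false.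
      by move=> n1 n2; apply: negbTE; rewrite eq_sym gneq // eq_sym.
    rewrite !nz //= andbT; apply/idP/idP.
      by case/(contr_lift cg) => a [b [/(sg _ nux nuy)-> /(sg _ nwx nwy)->]].
    move=> auw; apply: (contr_adj cg) => //; apply: gneq => //.
    exact: (adj_neq bU).
  by move=> l; rewrite /k eq_sym (negPf (inner_neq l iy)) /= gl.
exact: stable_tree_stable.
Qed.

(** * Labeling steps as contractions *)

Section BranchMin.
Variables (m : nat) (U : lgraph m.+3) (i : 'I_m.+3).
Hypothesis sU : stable_tree U.

Let bU : bridged U. Proof. by case: sU. Qed.
Let symU : symmetric (@adj _ U). Proof. by case: bU. Qed.

(** The branch of [a] at [x] is the side of [y], and the branch of [i] is the
    leaf [i] alone. *)
Lemma branch_at_x (x y : vert U) l :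
  adj (leaf U i) x -> adj x y -> side y x (leaf U label_a) ->
  (exists2 B, B \in branches x &
     [/\ leaf U l \in B, leaf U label_a \notin B & leaf U i \notin B]) <->
  (l != i) && side x y (leaf U l).
Proof.
move=> aix axy ya; have ix := leaf_nbr_inner sU aix.
have axi : adj x (leaf U i) by rewrite symU.
have ayx : adj y x by rewrite symU.
split=> [[B /(branchesP bU)[u axu ->]]|/andP[nli xl]].
  rewrite !inE => -[ul nua nui]; have nuy : u != y by apply: contraNneq nua => ->.
  rewrite (side_sub bU ayx axu nuy ul) andbT.
  by apply: contraNneq nui => <-.
have nlx : leaf U l != x by rewrite eq_sym inner_neq.
have [u axu ul] := side_ex bU nlx.
exists [set w | side u x w]; first by apply/(branchesP bU); exists u.
rewrite !inE; split=> //.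
  apply: contraTN xl => ua; rewrite -(side_neg bU) //.
  by rewrite -(side_uniq bU axu axy ua ya).
apply: contra nli; rewrite (side_nbr bU) // => /eqP e; rewrite e in ul.
by apply/eqP/(leaf_inj sU)/(leaf_side sU aix).
Qed.

(** The branch of [a] at [y] is the side of [r], and the branch of [i] is the
    side of [x]. *)
Lemma branch_at_y (x y r : vert U) l :
  adj x y -> adj y r -> r != x -> side x y (leaf U i) -> side r y (leaf U label_a) ->
  inner y ->
  (exists2 B, B \in branches y &
     [/\ leaf U l \in B, leaf U label_a \notin B & leaf U i \notin B]) <->
  side y x (leaf U l) && ~~ side r y (leaf U l).
Proof.
move=> axy ayr nrx xi ra iy; have ayx : adj y x by rewrite symU.
split=> [[B /(branchesP bU)[u ayu ->]]|/andP[yl nrl]].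
  rewrite !inE => -[ul nua nui].
  have nux : u != x by apply: contraNneq nui => ->.
  rewrite (side_sub bU axy ayu nux ul) /=; apply: contra nua => rl.
  by rewrite (side_uniq bU ayu ayr ul rl).
have nly : leaf U l != y by rewrite eq_sym inner_neq.
have [u ayu ul] := side_ex bU nly.
exists [set w | side u y w]; first by apply/(branchesP bU); exists u.
rewrite !inE; split=> //.
  by apply: contra nrl => ua; rewrite -(side_uniq bU ayu ayr ua ra).
apply: contraTN yl => ui; rewrite -(side_neg bU) //.
by rewrite -(side_uniq bU ayu ayx ui xi).
Qed.

Lemma unslide_stepP (x y : vert U) mx my :
  [/\ adj (leaf U i) x,
      first_step x (leaf U label_a) y /\ y <> leaf U label_a,
      is_branch_min i x mx /\ is_branch_min i y my & my < mx] <->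
  exists r, unslide i x y r mx my.
Proof.
split=> [[aix [/(first_stepP bU)[axy ya] nya] [minx miny] ltm]|[r us]].
  have [r [ayr nrx ra]] : exists r, [/\ adj y r, r != x & side r y (leaf U label_a)].
    by apply: (side_next bU axy ya); apply/eqP => /esym.
  have ayx : adj y x by rewrite symU.
  have iy : inner y := two_nbrs_inner sU ayr ayx nrx.
  have xi : side x y (leaf U i).
    by apply: side_other => //; rewrite 1?symU // eq_sym inner_neq.
  exists r; split=> //.
    by apply: is_min_ext minx => l; apply: branch_at_x.
  by split=> //; apply: is_min_ext miny => l; apply: branch_at_y.
have [_ iy] := unslide_inner sU us; have xi := unslide_side_i sU us.
have [aix axy [ayr nrx ra] minx [miny ltm]] := us.
have ya : side y x (leaf U label_a) := side_sub bU axy ayr nrx ra.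
split=> //.
- split; first exact/(first_stepP bU).
  by move=> e; rewrite e inner_leaf in iy.
- split.
    by apply: is_min_ext minx => l; apply: iff_sym; apply: branch_at_x.
  by apply: is_min_ext miny => l; apply: iff_sym; apply: branch_at_y.
Qed.

End BranchMin.

Section Contracted.
Variables (n : nat) (T : lgraph n.+3).
Hypothesis bT : bridged T.
Implicit Types lab : edge_labeling T.

Definition contr_map lab : vert T -> vert (contracted lab) :=
  @quot_map n.+3 n.+3 T (labeled_edge lab) id.

Lemma labeled_sym lab : symmetric (labeled_edge lab).
Proof.
by move=> x y; rewrite /labeled_edge /= setUC; have [-> _ _ _] := bT.
Qed.

Lemma contr_mapP lab : contraction (contr_map lab).
Proof. by apply: quot_contr; [apply: labeled_sym | move=> x y /andP[]]. Qed.

Lemma contr_mapE lab x y :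
  contr_map lab x = contr_map lab y <-> connect (labeled_edge lab) x y.
Proof. exact/quot_mapE/labeled_sym. Qed.

Lemma contr_leaf lab l : leaf (contracted lab) l = contr_map lab (leaf T l).
Proof. by []. Qed.

Lemma mem_contracted lab (u : vert (contracted lab)) x :
  (x \in val u) = (contr_map lab x == u).
Proof. exact/mem_quot/labeled_sym. Qed.

Definition add_label lab (l : 'I_n.+3) (x y : vert T) : edge_labeling T :=
  [ffun e => if e == [set x; y] then Some l else lab e].

Lemma set2_eq (x y u w : vert T) : adj u w -> [set u; w] = [set x; y] ->
  u = x /\ w = y \/ u = y /\ w = x.
Proof.
move=> auw /setP e; have nuw := adj_neq bT auw.
have := e u; rewrite !inE eqxx => /esym/orP[]/eqP uE; have := e w;
  rewrite !inE eqxx orbT => /esym/orP[]/eqP wE; auto;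
  by rewrite uE wE eqxx in nuw.
Qed.

(** Labeling one more edge adds exactly one edge to those that are contracted. *)
Lemma add_label_contraction lab l x y :
  adj x y -> contr_map lab x != contr_map lab y ->
  exists g : vert (contracted lab) -> vert (contracted (add_label lab l x y)),
    edge_contraction g (contr_map lab x) (contr_map lab y).
Proof.
move=> axy nxy; set lab' := add_label lab l x y.
have lab'E u w : labeled_edge lab' u w =
    labeled_edge lab u w || adj u w && ([set u; w] == [set x; y]).
  by rewrite /labeled_edge /= ffunE; case: eqP; case: (adj u w); rewrite ?orbT ?orbF.
have c1 := contr_mapP lab; have c2 := contr_mapP lab'.
have k12 u w : contr_map lab u = contr_map lab w -> contr_map lab' u = contr_map lab' w.
  move/contr_mapE => cuw; apply/contr_mapE; apply: connect_sub cuw => a b ab.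
  by apply: connect1; rewrite lab'E ab.
have [g cg gE] := contr_factor c1 c2 k12; exists g; split=> //.
- by move=> l'; rewrite !contr_leaf gE.
- exact: (contr_adj c1).
- rewrite !gE; apply/contr_mapE/connect1; rewrite lab'E axy eqxx orbT.
  by [].
move=> a b; have [u <-] := contr_surj c1 a; have [w <-] := contr_surj c1 b.
rewrite !gE => /contr_mapE.
(* Merging the two ends of the new edge identifies the vertices that the new
labeling links, so no other vertices get identified. *)
pose kappa v := if contr_map lab v == contr_map lab y then contr_map lab x else contr_map lab v.
move/(@connect_const _ _ _ kappa) => h.
have /h : forall p q, labeled_edge lab' p q -> kappa p = kappa q.
  move=> p q; rewrite lab'E => /orP[pq|/andP[apq /eqP/(set2_eq apq)[][-> ->]]].
  - by rewrite /kappa; have -> : contr_map lab p = contr_map lab q by apply/contr_mapE/connect1.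
  - by rewrite /kappa eqxx (negPf nxy).
  - by rewrite /kappa eqxx (negPf nxy).
rewrite /kappa; case: eqP => [->|_]; case: eqP => [->|_] => e.
- by constructor 1.
- by constructor 3.
- by constructor 2.
- by constructor 1.
Qed.

Lemma label_stepP ty l lab lab' : stable_tree (contracted lab) ->
  label_step ty l lab lab' <->
  exists x y r mx my,
    [/\ unslide l (contr_map lab x) (contr_map lab y) r mx my,
        ty = Omega -> mx < l, adj x y & lab' = add_label lab l x y].
Proof.
move=> sW; split.
  case=> v [vbar [mv [mvbar [x [y [ali st br cmp [xv yv axy ->]]]]]]].
  rewrite !mem_contracted in xv yv; rewrite -(eqP xv) -(eqP yv) in ali st br.
  have ltm : mvbar < mv by case: ty cmp => [[]|].
  have [r us] : exists r, unslide l (contr_map lab x) (contr_map lab y) r mv mvbar.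
    by apply/(unslide_stepP _ sW).
  exists x, y, r, mv, mvbar; split=> // e.
  by move: cmp; rewrite e; case.
case=> x [y [r [mx [my [us om axy ->]]]]].
have [ali st br ltm] : [/\ _, _, _ & _] := proj2 (unslide_stepP _ sW _ _ _ _) (ex_intro _ r us).
exists (contr_map lab x), (contr_map lab y), mx, my, x, y; split=> //.
  by case: ty om => // om; split=> //; apply: om.
by split=> //; rewrite mem_contracted.
Qed.

Lemma label_step_ec ty l lab lab' : stable_tree (contracted lab) ->
  label_step ty l lab lab' ->
  exists g : vert (contracted lab) -> vert (contracted lab'), exists v vbar r mx my,
    [/\ edge_contraction g v vbar, unslide l v vbar r mx my & ty = Omega -> mx < l].
Proof.
move=> sW /(label_stepP _ _ _ sW)[x [y [r [mx [my [us om axy ->]]]]]].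
have nxy : contr_map lab x != contr_map lab y.
  by have [_ a _ _ _] := us; have [bW _ _ _] := sW; apply: (adj_neq bW).
have [g ec] := add_label_contraction l axy nxy.
by exists g, (contr_map lab x), (contr_map lab y), r, mx, my.
Qed.

Lemma label_step_stable ty l lab lab' : stable_tree (contracted lab) ->
  label_step ty l lab lab' -> stable_tree (contracted lab').
Proof.
move=> sW /(label_step_ec sW)[g [v [vbar [r [mx [my [ec us _]]]]]]].
by have [iv ivb] := unslide_inner sW us; apply: ec_stable ec iv ivb.
Qed.

Lemma label_step_card ty l lab lab' : stable_tree (contracted lab) ->
  label_step ty l lab lab' -> #|vert (contracted lab')|.+1 = #|vert (contracted lab)|.
Proof.
move=> sW /(label_step_ec sW)[g [v [vbar [r [mx [my [ec us _]]]]]]].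
exact: ec_card ec.
Qed.

End Contracted.

(** * Removing the largest labels *)

Definition kept (t m : nat) (W : lgraph m) (u : vert W) : bool :=
  [forall l : 'I_m, (t <= l) ==> (leaf W l != u)].

(** The leaves with label at least [t + 3] are removed by contracting their
    edges: each is merged with its neighbour, and nothing else is merged. *)
Definition pruning (n t : nat) (W : lgraph n.+3) (U : lgraph t.+3)
    (p : vert W -> vert U) : Prop :=
  [/\ contraction p,
      forall (l : 'I_t.+3) (l' : 'I_n.+3), l = l' :> nat -> leaf U l = p (leaf W l'),
      forall (l : 'I_n.+3) w, t.+3 <= l -> adj (leaf W l) w -> p (leaf W l) = p w &
      forall u w, p u = p w -> kept t.+3 u -> kept t.+3 w -> u = w].

Lemma keptPn (t m : nat) (W : lgraph m) (u : vert W) :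
  ~~ kept t u -> exists2 l : 'I_m, t <= l & u = leaf W l.
Proof.
rewrite negb_forall => /existsP[l]; rewrite negb_imply negbK => /andP[tl /eqP e].
by exists l.
Qed.

Lemma inner_kept (t m : nat) (W : lgraph m) (u : vert W) : inner u -> kept t u.
Proof. by move=> iu; apply/forallP => l; rewrite eq_sym inner_neq ?implybT. Qed.

Lemma kept_leaf (t m : nat) (W : lgraph m) (l : 'I_m) :
  injective (@leaf m W) -> kept t (leaf W l) = (l < t).
Proof.
move=> inj_l; apply/forallP/idP => [/(_ l)|lt l'].
  by rewrite eqxx implybF -ltnNge.
rewrite (inj_eq inj_l); apply/implyP => le; apply: contraTneq lt => <-.
by rewrite -leqNgt.
Qed.

Definition lower (n t : nat) (h : t <= n) : 'I_t.+3 -> 'I_n.+3 :=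
  @widen_ord t.+3 n.+3 h.

Lemma lowerE n t (h : t <= n) l : lower h l = l :> nat.
Proof. by []. Qed.

Section PruneExists.
Variables (n t : nat) (W : lgraph n.+3) (h : t <= n).
Hypothesis sW : stable_tree W.

Definition prune_rel : rel (vert W) :=
  [rel u w | adj u w && ~~ (kept t.+3 u && kept t.+3 w)].

Definition prune : lgraph t.+3 := quotient prune_rel (lower h).

Definition prune_map : vert W -> vert prune := quot_map prune_rel (lower h).

Lemma prune_map_pruning : pruning prune_map.
Proof.
have [bW _ _ _] := sW; have [symW irrW _ _] := bW.
have symR : symmetric prune_rel by move=> u w; rewrite /prune_rel /= symW [kept _ w && _]andbC.
have Radj : subrel prune_rel (@adj _ W) by move=> u w /andP[].
have kE := quot_mapE (lower h) symR.
split.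
- exact: quot_contr.
- move=> l l' e; have -> : l' = lower h l by apply: val_inj.
  by [].
- move=> l w tl alw; apply/kE/connect1.
  by rewrite /prune_rel /= alw (kept_leaf _ _ (leaf_inj sW)) negb_and -leqNgt tl.
move=> u w /kE cuw tu tw.
(* Moving each removed leaf to its neighbour is constant along the contracted
edges and fixes the other vertices. *)
pose kappa (v : vert W) := if kept t.+3 v then v else odflt v [pick z | adj v z].
suff: kappa u = kappa w by rewrite /kappa tu tw.
apply: connect_const cuw.
suff half (a b : vert W) : adj a b -> ~~ kept t.+3 a -> kappa a = kappa b.
  move=> a b /andP[aab]; rewrite negb_and => /orP[na|nb].
    exact: half.
  by apply/esym/half => //; rewrite symW.
move=> aab na; have [l tl al] := keptPn na; rewrite al in aab.
rewrite /kappa (negPf na) (inner_kept _ (leaf_nbr_inner sW aab)) al.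
case: pickP => [z /= alz|/(_ b)]; last by rewrite aab.
exact: (leaf_adj_uniq sW alz aab).
Qed.

End PruneExists.

Section Pruning.
Variables (n t : nat) (W : lgraph n.+3) (U : lgraph t.+3) (p : vert W -> vert U).
Hypotheses (h : t <= n) (sW : stable_tree W) (pp : pruning p).

Let bW : bridged W. Proof. by case: sW. Qed.
Let symW : symmetric (@adj _ W). Proof. by case: bW. Qed.
Let irrW : irreflexive (@adj _ W). Proof. by case: bW. Qed.

Lemma prune_retract u : exists2 w, kept t.+3 w & p w = p u.
Proof.
have [_ _ pb _] := pp.
have [tu|/keptPn[l tl ->]] := boolP (kept t.+3 u); first by exists u.
have [w alw _] := leaf_nbr sW l; exists w; last by rewrite (pb l w).
exact/inner_kept/(leaf_nbr_inner sW alw).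
Qed.

Lemma prune_lift (x y : vert U) : adj x y ->
  exists a b, [/\ p a = x, p b = y, adj a b, kept t.+3 a & kept t.+3 b].
Proof.
have [cp _ pb _] := pp => axy; have [a [b [xa yb aab]]] := contr_lift cp axy.
have nab : p a != p b by rewrite xa yb; apply: (contr_neq cp).
exists a, b; split=> //; apply: contraT => /keptPn[l tl e].
  by move: nab; rewrite e (pb l b) ?eqxx // -e.
by move: nab; rewrite e (pb l a) ?eqxx // -e symW.
Qed.

Lemma prune_const (S : Type) (g : vert W -> S) :
  (forall (l : 'I_n.+3) w, t.+3 <= l -> adj (leaf W l) w -> g (leaf W l) = g w) ->
  forall u w, p u = p w -> g u = g w.
Proof.
have [cp _ _ pk] := pp => gb u w /(contr_fiber cp).
apply: connect_const => a b /andP[aab /eqP pab].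
have [ta|/keptPn[l tl e]] := boolP (kept t.+3 a); last by rewrite e (gb l b) // -e.
have [tb|/keptPn[l tl e]] := boolP (kept t.+3 b); last by rewrite e (gb l a) // -e symW.
by move: aab; rewrite (pk a b) // irrW.
Qed.

Lemma lower_kept i : kept t.+3 (leaf W (lower h i)).
Proof. by rewrite (kept_leaf _ _ (leaf_inj sW)) lowerE ltn_ord. Qed.

Lemma lower_leaf l : leaf U l = p (leaf W (lower h l)).
Proof. by have [_ pl _ _] := pp; apply: pl. Qed.

(** If [r] is a leaf then it is the leaf [a], since [a] lies on its side. *)
Lemma unslide_kept i x y r mx my : unslide i x y r mx my ->
  [/\ @kept t.+3 _ W x, kept t.+3 y & kept t.+3 r].
Proof.
move=> us; have [ix iy] := unslide_inner sW us.
split; [exact: inner_kept | exact: inner_kept |].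
have [_ _ [ayr _ ra] _ _] := us; apply: contraT => /keptPn[l tl e].
move: ra; rewrite e => /(leaf_side sW); rewrite symW -e => /(_ ayr) ea.
by move: ea tl; rewrite e => /(leaf_inj sW) <-.
Qed.

Lemma unslide_prune i x y r mx my mx' my' :
  mx = lower h mx' -> my = lower h my' ->
  unslide (lower h i) x y r mx my -> unslide i (p x) (p y) (p r) mx' my'.
Proof.
move=> -> -> us; have [cp _ _ pk] := pp.
have [tx ty tr] := unslide_kept us.
have [aix axy [ayr _ _] _ _] := us.
have neq (a b : vert W) : adj a b -> kept t.+3 a -> kept t.+3 b -> p a != p b.
  by move=> aab ta tb; apply: contraTneq aab => /pk ->; rewrite ?irrW.
apply/(unslide_transfer cp bW (lowerE h) lower_leaf) => //; apply: neq => //.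
exact: lower_kept.
Qed.

Lemma unslide_unprune i X Y R mx my : unslide i X Y R mx my ->
  exists x y r, [/\ p x = X, p y = Y, p r = R &
    unslide (lower h i) x y r (lower h mx) (lower h my)].
Proof.
move=> us; have [cp _ _ pk] := pp; have bU := contr_bridged cp bW.
have [aiX aXY [aYR _ _] _ _] := us.
have [x [y [xE yE axy tx ty]]] := prune_lift aXY.
have [y' [r [yE' rE ayr ty' tr]]] := prune_lift aYR.
have [i' [x' [iE xE' aix ti tx']]] := prune_lift aiX.
have yy : y' = y by apply: pk => //; rewrite yE yE'.
have xx : x' = x by apply: pk => //; rewrite xE xE'.
have ii : i' = leaf W (lower h i).
  by apply: pk => //; [rewrite iE lower_leaf | apply: lower_kept].
rewrite yy in ayr; rewrite ii xx in aix.
exists x, y, r; split=> //; rewrite -xE -yE -rE in us.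
apply/(unslide_transfer cp bW (lowerE h) lower_leaf) => //.
- by rewrite -lower_leaf xE; apply: (contr_neq cp).
- by rewrite xE yE; apply: (contr_neq cp).
- by rewrite yE rE; apply: (contr_neq cp).
Qed.

End Pruning.

Lemma prune_unique (n t : nat) (W : lgraph n.+3) (U1 U2 : lgraph t.+3)
    (p1 : vert W -> vert U1) (p2 : vert W -> vert U2) :
  t <= n -> stable_tree W -> pruning p1 -> pruning p2 -> iso U1 U2.
Proof.
move=> h sW pp1 pp2; have [c1 _ b1 _] := pp1; have [c2 _ b2 _] := pp2.
apply: (iso_of_kernel c1 c2 (iota := lower h)) => [x y|l|l].
- split; first exact: (prune_const sW pp1 b2).
  exact: (prune_const sW pp2 b1).
- exact: lower_leaf.
exact: lower_leaf.
Qed.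

Lemma prune_full (n : nat) (W : lgraph n.+3) (U : lgraph n.+3) (p : vert W -> vert U) :
  stable_tree W -> pruning p -> iso W U.
Proof.
move=> sW [cp pl _ pk]; have [[_ irrW _ _] _ _ _] := sW.
apply: (contr_iso irrW cp) => [u w puw|l]; last by rewrite (pl l l).
by apply: pk puw _ _; apply/forallP => l; rewrite leqNgt ltn_ord.
Qed.

(** Both composites contract [xy] and the edges at the large leaves. *)
Lemma prune_ec (n t : nat) (W W' : lgraph n.+3) (U U' : lgraph t.+3)
    (p : vert W -> vert U) (p' : vert W' -> vert U') (g : vert W -> vert W') x y :
  t <= n -> stable_tree W -> pruning p -> pruning p' ->
  edge_contraction g x y -> inner x -> inner y ->
  exists k : vert U -> vert U', edge_contraction k (p x) (p y).
Proof.
move=> h sW pp pp' ec ix iy.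
have [cg gl axy gxy kg] := ec.
have [cp pl pb pk] := pp; have [cp' pl' pb' pk'] := pp'.
have [bW _ _ _] := sW; have [symW irrW _ _] := bW.
have c2 := contr_comp cg cp'.
have k12 : forall u w, p u = p w -> (p' \o g) u = (p' \o g) w.
  apply: (prune_const sW pp) => l w tl alw /=.
  have [->//|nlw] := eqVneq (g (leaf W l)) (g w).
  by rewrite -gl; apply: pb' => //; rewrite gl; apply: (contr_adj cg).
have [k ck kE] := contr_factor cp c2 k12; exists k; split=> //.
- by move=> l; rewrite (lower_leaf h pp) (lower_leaf h pp') gl kE.
- apply: (contr_adj cp) => //; apply: contraTneq axy => /pk -> //; last 2 first.
  + exact: inner_kept.
  + exact: inner_kept.
  by rewrite irrW.
- by rewrite !kE /= gxy.
have gt a : kept t.+3 a -> kept t.+3 (g a).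
  move=> /forallP ta; apply/forallP => l; apply/implyP => tl.
  apply: contraTneq (implyP (ta l) tl) => e; rewrite negbK eq_sym; apply/eqP.
  by apply: (ec_single ec); rewrite 1?eq_sym ?inner_neq // -gl.
move=> u w; have [a ta <-] : exists2 a, kept t.+3 a & p a = u.
  by have [b <-] := contr_surj cp u; apply: prune_retract.
have [b tb <-] : exists2 a, kept t.+3 a & p a = w.
  by have [b <-] := contr_surj cp w; apply: prune_retract.
rewrite !kE /= => /pk' /(_ (gt _ ta) (gt _ tb)) /kg[->|[-> ->]|[-> ->]].
- by constructor 1.
- by constructor 2.
- by constructor 3.
Qed.

Lemma prune_step (n t : nat) (W : lgraph n.+3) (U1 : lgraph t.+4) (U0 : lgraph t.+3)
    (p1 : vert W -> vert U1) (p0 : vert W -> vert U0) :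
  t < n -> stable_tree W -> pruning p1 -> pruning p0 ->
  exists k : vert U1 -> vert U0, @pruning t.+1 t U1 U0 k.
Proof.
move=> h sW pp1 pp0.
have [c1 l1 b1 k1] := pp1; have [c0 l0 b0 k0] := pp0.
have k12 : forall u w, p1 u = p1 w -> p0 u = p0 w.
  by apply: (prune_const sW pp1) => l w tl; apply: b0; apply: ltnW.
have [k ck kE] := contr_factor c1 c0 k12; exists k; split=> //.
- move=> l l' e; rewrite (lower_leaf h pp1) kE; apply: l0.
  by rewrite e.
- move=> l w tl /(prune_lift sW pp1)[a [b [aE bE aab ta tb]]].
  rewrite -bE -aE !kE.
  have e : a = leaf W (lower h l).
    by apply: k1 => //; [rewrite aE (lower_leaf h pp1) | apply: lower_kept].
  by rewrite e in aab *; apply: b0.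
move=> u w.
have [a ta <-] : exists2 a, kept t.+4 a & p1 a = u.
  by have [b <-] := contr_surj c1 u; apply: prune_retract.
have [b tb <-] : exists2 a, kept t.+4 a & p1 a = w.
  by have [b <-] := contr_surj c1 w; apply: prune_retract.
have small a' : kept t.+4 a' -> kept t.+3 (p1 a') -> kept t.+3 a'.
  move=> ta' ta1; apply: contraT => /keptPn[l tl e].
  have l4 : l < t.+4 by rewrite -(kept_leaf t.+4 l (leaf_inj sW)) -e.
  have /forallP/(_ (Ordinal l4)) := ta1.
  by rewrite (l1 (Ordinal l4) l) //= tl -e eqxx.
rewrite !kE => e /(small _ ta) ta0 /(small _ tb) tb0.
by rewrite (k0 a b).
Qed.

(** * Inserting the largest leaf *)

Lemma inj_surj_bij (V V' : finType) (f : V -> V') :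
  injective f -> (forall u, exists x, f x = u) -> bijective f.
Proof.
move=> inj_f /fin_all_exists[h hK]; exists h => // x; exact: inj_f.
Qed.

Section Insert.
Variables (m : nat) (V : lgraph m.+3) (v : vert V).
Hypotheses (sV : stable_tree V) (iv : inner v).

Let S := insert_leaf v.
Let q (u : vert S) : vert V := odflt v u.

Lemma insert_symmetric : symmetric (@adj _ S).
Proof.
have [[symV _ _ _] _ _ _] := sV.
by case=> [a|] [b|] //=; rewrite symV.
Qed.

Lemma insert_contraction : contraction (q : vert S -> vert V).
Proof.
have [[symV irrV _ _] _ _ _] := sV.
split.
- by move=> u; exists (Some u).
- case=> [a|] [b|]; rewrite /q /= => e.
  + by rewrite e connect0.
  + by apply: connect1; rewrite /= e !eqxx.
  + by apply: connect1; rewrite /= e !eqxx.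
  exact: connect0.
move=> u w; split=> [auw|].
  split; first by move=> e; rewrite e irrV in auw.
  by exists (Some u), (Some w).
case=> nuw [[a|] [[b|] []]]; rewrite /q /= => xu yw; rewrite -xu -yw //.
  by move/eqP => e; case: nuw; rewrite -xu -yw e.
by move/eqP => e; case: nuw; rewrite -xu -yw e.
Qed.

Lemma insert_bridged : bridged S.
Proof.
have [[symV irrV cV bV] _ _ _] := sV; have symS := insert_symmetric.
have cS0 a : connect (@adj _ S) (Some v) a.
  case: a => [a|]; last by apply: connect1; rewrite /= eqxx.
  by apply: (@connect_homo _ _ _ _ Some) (cV v a) => x y axy; apply: connect1.
split=> //.
- by case=> [a|] //=.
- move=> a b; apply: connect_trans (cS0 b).
  by rewrite (sym_connect_sym symS).
case=> [x|] [y|] // axy; apply/negP => h.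
- case/negP: (bV x y axy); move: h; rewrite /side.
  apply: (@connect_homo _ _ _ _ q) => -[a|] [b|] //= /andP[aab nab].
  + by apply: connect1; rewrite /cut /=; apply/andP.
  + by rewrite (eqP aab) connect0.
  by rewrite (eqP aab) connect0.
- suff: (None : vert S) <> None by [].
  apply: (@connect_induct _ _ (fun z : vert S => z <> None) _ _ _ _ h) => // a b na /andP[].
  case: a b na => [a|] [b|] //= _ /eqP -> /=; rewrite (eqP axy : x = v).
  by rewrite eqxx.
suff: (Some y : vert S) = None by [].
apply: (@connect_induct _ _ (fun z : vert S => z = None) _ _ _ _ h) => // a b -> /andP[].
by case: b => [b|] //= /eqP ->; rewrite (eqP axy : y = v) !eqxx.
Qed.

Lemma insert_deg (a : vert V) : deg (Some a : vert S) = deg a + (a == v).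
Proof.
have -> : deg (Some a : vert S) =
    #|Some @: [set w | adj a w] :|: (if a == v then [set None] else set0)|.
  apply: eq_card => -[w|]; rewrite !inE /=.
    rewrite mem_imset ?inE //; last by move=> ? ? [].
    by case: (a == v); rewrite ?inE ?orbF.
  suff -> : (None \in Some @: [set w | adj a w]) = false by case: (a == v); rewrite inE.
  by apply/negP => /imsetP[].
rewrite cardsU card_imset; last by move=> ? ? [].
case: (a == v); last by rewrite setI0 cards0 subn0.
rewrite cards1; suff -> : Some @: [set w | adj a w] :&: [set None] = set0 by rewrite cards0 subn0.
by apply/setP => -[w|]; rewrite !inE ?andbF //; apply/negP => /andP[/imsetP[]].
Qed.

Lemma insert_stable : stable_tree S.
Proof.
have [bV inj_l leaf1 inner3] := sV; have nvl l := inner_neq l iv.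
have leafE (l : 'I_m.+4) : leaf S l =
    if unlift ord_max l is Some l' then Some (leaf V l') else None.
  by [].
split.
- exact: insert_bridged.
- move=> l l'; rewrite !leafE.
  by case: unliftP => [j ->|->]; case: unliftP => [j' ->|->] // -[/inj_l ->].
- move=> l; rewrite leafE; case: unliftP => [j _|_].
    by rewrite insert_deg leaf1 eq_sym (negPf (nvl j)).
  apply/eqP/cards1P; exists (Some v); apply/setP => -[w|]; rewrite !inE //=.
have lS l : leaf S (lift ord_max l) = Some (leaf V l) by rewrite leafE liftK.
case=> [a|] ia; last first.
  by case/negP: ia; apply/codomP; exists ord_max; rewrite leafE unlift_none.
rewrite insert_deg ltn_addr //; apply: inner3.
by apply: contraNN ia => /codomP[l ->]; rewrite -lS codom_f.
Qed.

End Insert.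

Section InsertPrune.
Variables (t : nat) (U : lgraph t.+4).
Hypothesis sU : stable_tree U.

Let bU : bridged U. Proof. by case: sU. Qed.
Let symU : symmetric (@adj _ U). Proof. by case: bU. Qed.
Let irrU : irreflexive (@adj _ U). Proof. by case: bU. Qed.

Lemma kept_last (u : vert U) : kept t.+3 u = (u != leaf U ord_max).
Proof.
apply/forallP/idP => [/(_ ord_max)|nu l]; first by rewrite leqnn /= eq_sym.
apply/implyP => tl; have -> : l = ord_max.
  by apply: val_inj => /=; apply/eqP; rewrite eqn_leq tl -ltnS ltn_ord.
by rewrite eq_sym.
Qed.

(** Inserting a leaf at [v] is undone by merging it with [v]. *)
Lemma insert_iso_prune (V : lgraph t.+3) (v : vert V) :
  stable_tree V -> iso (insert_leaf v) U ->
  exists k : vert U -> vert V, @pruning t.+1 t U V k.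
Proof.
move=> sV isoU.
have [k [ck bk kl]] := iso_contr irrU (iso_sym isoU).
have cq := insert_contraction v sV.
exists (fun u => odflt v (k u)); split.
- exact: contr_comp ck cq.
- move=> l l' e; rewrite kl; have -> : l' = lift ord_max l.
    by apply: val_inj; rewrite /= -e /bump leqNgt ltn_ord.
  by rewrite /= liftK.
- move=> l w tl alw; have lE : l = ord_max.
    by apply: val_inj => /=; apply/eqP; rewrite eqn_leq tl -ltnS ltn_ord.
  have /(contr_adj ck alw) : k (leaf U l) != k w.
    by rewrite (bij_eq bk) (adj_neq bU).
  by rewrite kl lE /= unlift_none /=; case: (k w) => [w'|] //= /eqP ->.
have kN u : (k u == None) = (u == leaf U ord_max).
  by rewrite -(bij_eq bk) kl /= unlift_none.
move=> u w; rewrite !kept_last -!kN.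
by case ku: (k u) => [a|] //; case kw: (k w) => [b|] //= e _ _;
  apply: (bij_inj bk); rewrite ku kw e.
Qed.

Variables (V : lgraph t.+3) (k : vert U -> vert V).
Hypothesis pk : @pruning t.+1 t U V k.

(** Away from the last leaf the pruning is injective, so that sending this leaf
    to the inserted vertex [None] gives an isomorphism. *)
Lemma prune_insert_iso : exists2 v : vert V, inner v & iso (insert_leaf v) U.
Proof.
have [ck kl kb kk] := pk.
have [w0 aw0 uw0] := leaf_nbr sU ord_max.
have kw0 : k (leaf U ord_max) = k w0 by apply: kb.
have iw0 := leaf_nbr_inner sU aw0.
exists (k w0).
  apply/negP => /codomP[l]; have h := leqnSn t; rewrite (lower_leaf h pk) => /kk e.
  by have := iw0; rewrite (e (inner_kept _ iw0) (lower_kept h sU l)) inner_leaf.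
apply: iso_sym.
pose f (u : vert U) : vert (insert_leaf (k w0)) := if u == leaf U ord_max then None else Some (k u).
have trk u : u != leaf U ord_max -> kept t.+3 u by rewrite kept_last.
have n0 : w0 != leaf U ord_max by apply: inner_neq.
have inj_f : injective f.
  move=> u w; rewrite /f; case: eqP => [->|/eqP nu]; case: eqP => [->|/eqP nw] // [].
  by move/kk => ->; rewrite ?trk.
exists f; split.
- apply: inj_surj_bij => // -[z|]; last by exists (leaf U ord_max); rewrite /f eqxx.
  have [u <-] := contr_surj ck z; have [->|nu] := eqVneq u (leaf U ord_max).
    by exists w0; rewrite /f (negPf n0) kw0.
  by exists u; rewrite /f (negPf nu).
- have half w : w != leaf U ord_max -> (k w == k w0) = adj (leaf U ord_max) w.
    by move=> nw; apply/eqP/idP => [/kk ->|/uw0 ->]; rewrite ?trk.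
  move=> u w; rewrite /f; case: eqP => [->|/eqP nu]; case: eqP => [->|/eqP nw] /=.
  + by rewrite irrU.
  + exact: half.
  + by rewrite symU half.
  apply/idP/idP => [/(prune_lift sU pk)[a [b [/kk ea /kk eb aab ta tb]]]|auw].
    by rewrite -(ea ta (trk _ nu)) -(eb tb (trk _ nw)).
  apply: (contr_adj ck) => //; apply: contraTneq auw => /kk ->; rewrite ?irrU ?trk //.
move=> l; rewrite /f /=; case: unliftP => [j lE|->]; last by rewrite eqxx.
rewrite (inj_eq (leaf_inj sU)); case: eqP => [e|_] /=.
  by have := neq_lift ord_max j; rewrite -lE e eqxx.
rewrite (kl j l) // lE /= /bump leqNgt ltn_ord.
by [].
Qed.

(** Only the neighbour of the removed leaf loses a neighbour, so it must have
    at least four of them. *)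
Lemma prune_stable (w0 : vert U) : adj (leaf U ord_max) w0 ->
  (forall p q, exists r, [/\ adj w0 r, r != leaf U ord_max, r != p & r != q]) ->
  stable_tree V.
Proof.
move=> aw0 wide; have [ck kl kb kk] := pk.
have kw0 : k (leaf U ord_max) = k w0 by apply: kb.
have iw0 := leaf_nbr_inner sU aw0.
have trk u : u != leaf U ord_max -> kept t.+3 u by rewrite kept_last.
have n0 : w0 != leaf U ord_max by apply: inner_neq.
have kdeg u : u != leaf U ord_max -> u != w0 -> deg (k u) = deg u.
  move=> nu nu0; apply: (contr_deg ck bU) => w.
  have [->|nw /kk] := eqVneq w (leaf U ord_max); last by apply; apply: trk.
  by rewrite kw0 => /kk e; rewrite -(e (trk _ n0) (trk _ nu)) eqxx in nu0.
have h := leqnSn t; have lE := lower_leaf h pk.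
have low l : leaf U (lower h l) != leaf U ord_max by rewrite -kept_last; apply: lower_kept.
have [_ inj_l leaf1 inner3] := sU.
split.
- exact: contr_bridged ck bU.
- move=> l l'; rewrite !lE => /kk e.
  have /inj_l/(congr1 val) /= e' := e (trk _ (low l)) (trk _ (low l')).
  exact: val_inj.
- by move=> l; rewrite lE kdeg ?leaf1 // eq_sym inner_neq.
move=> z; have [u0 <-] := contr_surj ck z; have [u tu <-] := prune_retract sU pk u0.
move=> iz; have iu : inner u.
  apply: contraTT iz => /innerPn[l ul]; rewrite negbK ul.
  move: tu; rewrite ul (kept_leaf _ _ (leaf_inj sU)) => lt.
  by rewrite -(kl (Ordinal lt) l) // codom_f.
have nu : u != leaf U ord_max by apply: inner_neq.
have [->|nu0] := eqVneq u w0; last by rewrite kdeg // inner3.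
apply/deg_gt2P => p q.
have [p1 <-] := contr_surj ck p; have [p0 tp <-] := prune_retract sU pk p1.
have [q1 <-] := contr_surj ck q; have [q0 tq <-] := prune_retract sU pk q1.
have [r [awr nrl nrp nrq]] := wide p0 q0; exists (k r); have tr := trk r nrl.
split.
- by apply: (contr_adj ck) => //; apply: contraTneq awr => /kk ->; rewrite ?irrU ?trk.
- by apply: contraNneq nrp => /kk ->.
by apply: contraNneq nrq => /kk ->.
Qed.

End InsertPrune.

(** * Counting vertices *)

(** Rooting the tree at [r], every vertex but [r] has exactly one neighbour
    towards [r], and every edge is directed towards [r] in exactly one way. *)
Lemma sum_deg (m : nat) (U : lgraph m) (r : vert U) :
  bridged U -> (\sum_(v : vert U) deg v).+2 = 2 * #|vert U|.
Proof.
move=> bU; have [symU irrU _ _] := bU.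
pose toward (v w : vert U) := adj v w && side w v r.
have degE (v : vert U) : deg v = \sum_w (toward v w + toward w v).
  rewrite /deg -sum1_card big_mkcond /=; apply: eq_bigr => w _.
  rewrite inE /toward [adj w v]symU; case avw: (adj v w) => //=.
  by rewrite (side_neg bU _ avw); case: side.
have out v : \sum_w toward v w = (v != r).
  have [->|nvr] /= := eqVneq v r.
    by apply: big1 => w _; rewrite /toward; case arw: (adj r w); rewrite //= side_far // symU.
  have [u avu ur] : exists2 u, adj v u & side u v r by apply: side_ex => //; rewrite eq_sym.
  rewrite (bigD1 u) //= /toward avu ur big1 // => w nwu.
  case avw: (adj v w) => //=; case wr: side => //.
  by rewrite (side_uniq bU avw avu wr ur) eqxx in nwu.
rewrite (eq_bigr _ (fun v _ => degE v)).
under eq_bigr do rewrite big_split /=.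
rewrite big_split /= [X in _ + X]exchange_big /= addnn -mul2n.
under eq_bigr do rewrite out.
have -> : \sum_v (v != r) = #|vert U|.-1.
  rewrite -(cardC1 r) -sum1_card [RHS]big_mkcond /=.
  by apply: eq_bigr => v _; rewrite inE; case: eqP.
have : 0 < #|vert U| by apply/card_gt0P; exists r.
by case: #|vert U| => // c _ /=; rewrite mulnS.
Qed.

Section Counting.
Variables (m : nat) (U : lgraph m.+3).
Hypothesis sU : stable_tree U.

Lemma card_inner : #|@inner _ U| + m.+3 = #|vert U|.
Proof.
rewrite -(cardC (@inner _ U)); congr (_ + _).
rewrite -[LHS](card_ord m.+3) -(card_codom (leaf_inj sU)).
by apply: eq_card => v; rewrite !inE /inner negbK.
Qed.

Lemma sum_inner_deg : m.+3 + \sum_(v : vert U | inner v) deg v + 2 = 2 * #|vert U|.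
Proof.
have [bU inj_l leaf1 _] := sU.
have := sum_deg (leaf U ord0) bU; rewrite (bigID (@inner _ U)) /=.
suff -> : \sum_(v : vert U | ~~ inner v) deg v = m.+3 by lia.
transitivity (\sum_(v in codom (leaf U)) 1); last by rewrite sum1_card card_codom // card_ord.
apply: eq_big => [v|v]; first by rewrite /inner negbK.
by case/innerPn=> l ->; rewrite leaf1.
Qed.

Lemma sum3_inner : \sum_(v : vert U | inner v) 3 = 3 * #|@inner _ U|.
Proof. by rewrite sum_nat_const mulnC. Qed.

(** Each of the [m + 3] leaves has degree one and every other vertex degree at
    least three, while the degrees add up to twice the number of edges. *)
Lemma stable_card_le : #|vert U| <= 2 * m + 4.
Proof.
have [_ _ _ inner3] := sU.
have : \sum_(v : vert U | inner v) 3 <= \sum_(v : vert U | inner v) deg v by apply: leq_sum.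
by move: sum_inner_deg card_inner; rewrite sum3_inner; lia.
Qed.

Lemma stable_card_ge : m.+4 <= #|vert U|.
Proof.
have [z alz _] := leaf_nbr sU ord0.
have : 0 < #|@inner _ U| by apply/card_gt0P; exists z; apply: (leaf_nbr_inner sU alz).
by move: card_inner; lia.
Qed.

(** Equality in [stable_card_le] leaves no room for a vertex of degree above
    three. *)
Lemma card_trivalent : #|vert U| = 2 * m + 4 -> trivalent U.
Proof.
move=> cU; have [_ _ leaf1 inner3] := sU.
have [labU _ _] := stable_tree_stable sU.
have E (v : vert U) : inner v -> 3 <= deg v ?= iff (3 == deg v).
  by move=> iv; split; first exact: inner3.
have [_ e] := leqif_sum E.
have /forall_inP deg3 : [forall (v : vert U | inner v), 3 == deg v].
  by rewrite -e sum3_inner; apply/eqP; move: sum_inner_deg card_inner; lia.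
split=> //.
  move=> v; have [/deg3/eqP|/innerPn[l ->]] := boolP (inner v); first by right.
  by left.
have [z alz _] := leaf_nbr sU ord0; exists z.
by apply/esym/eqP/deg3/(leaf_nbr_inner sU alz).
Qed.

Definition one_inner : Prop := forall u w : vert U, inner u -> inner w -> u = w.

Lemma card_one_inner : #|vert U| <= m.+4 -> one_inner.
Proof.
move=> cU u w iu iw; apply/eqP; apply: contraT => nuw.
have : 1 < #|@inner _ U| by apply/card_gt1P; exists u, w.
by move: card_inner; lia.
Qed.

(** The neighbour of a leaf is not a leaf, so all leaves are adjacent to the
    unique other vertex. *)
Lemma one_inner_star : one_inner -> iso (star m.+3) U.
Proof.
move=> one; have [[symU irrU _ _] _ _ _] := sU.
have [c ac _] := leaf_nbr sU ord0; have ic := leaf_nbr_inner sU ac.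
have alc l : adj (leaf U l) c.
  by have [z alz _] := leaf_nbr sU l; rewrite (one c z ic (leaf_nbr_inner sU alz)).
pose f (x : vert (star m.+3)) : vert U := if x is Some l then leaf U l else c.
exists f; split=> //.
  apply: inj_surj_bij => [[l|] [l'|] //= | v].
  - by move/(leaf_inj sU) ->.
  - by move=> e; move: ic; rewrite -e inner_leaf.
  - by move=> e; move: ic; rewrite e inner_leaf.
  have [iv|/innerPn[l ->]] := boolP (inner v); last by exists (Some l).
  by exists None; apply: one.
case=> [l|] [l'|] /=.
- by apply: contraFF (inner_leaf U l') => /(leaf_nbr_inner sU).
- by rewrite alc.
- by rewrite symU alc.
by rewrite irrU.
Qed.

Lemma deg_ge (v : vert U) (s : seq (vert U)) :
  uniq s -> (forall w, w \in s -> adj v w) -> size s <= deg v.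
Proof.
move=> /card_uniqP <- sub; apply: subset_leq_card; apply/subsetP => w /sub.
by rewrite inE.
Qed.

End Counting.

Lemma trivalent_stable (m : nat) (U : lgraph m) : trivalent U -> stable U.
Proof.
case=> labU deg13 [v dv]; split=> //; last by exists v; rewrite dv.
by move=> u; case: (deg13 u) => ->.
Qed.

(** The single inner vertex is adjacent to all of the at least four leaves. *)
Lemma one_inner_wide (t : nat) (U : lgraph t.+4) (v : vert U) :
  stable_tree U -> one_inner U -> adj (leaf U ord_max) v -> 3 < deg v.
Proof.
move=> sU one alv; have [[symU _ _ _] _ _ _] := sU.
have iv := leaf_nbr_inner sU alv.
have av l : adj v (leaf U l).
  by have [z alz _] := leaf_nbr sU l; rewrite symU (one v z iv (leaf_nbr_inner sU alz)).
have -> : 4 = size [seq leaf U (inord j) | j <- iota 0 4] by [].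
apply: deg_ge; last by move=> w /mapP[j _ ->].
rewrite map_inj_in_uniq ?iota_uniq // => i j; rewrite !mem_iota /= => i4 j4 /(leaf_inj sU).
by move/(congr1 val); rewrite /= !inordK //; lia.
Qed.

Lemma wide_nbr (t : nat) (U : lgraph t.+4) (v : vert U) : 3 < deg v ->
  forall p q, exists r, [/\ adj v r, r != leaf U ord_max, r != p & r != q].
Proof.
move=> dv p q; set l := leaf U ord_max.
have /subsetPn[r] : ~~ ([set w | adj v w] \subset l |: [set p; q]).
  apply: contraL dv => /subset_leq_card; rewrite -leqNgt => h; apply: leq_trans h _.
  by rewrite cardsU1 cards2; case: (p != q); case: (l \notin _).
by rewrite !inE !negb_or => avr /and3P[? ? ?]; exists r.
Qed.

(** If [v] were [X], its neighbours would be the last leaf, leaf [i] and [Y],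
    so that [mx] would be the last label, against [mx < i]. If [v] were [Y],
    they would be the last leaf, [X] and [R], and [my] would be the last
    label, against [my < mx < i]. *)
Lemma narrow_unslide (t : nat) (U U' : lgraph t.+4) (k : vert U -> vert U')
    (X Y R : vert U) (i mx my : 'I_t.+4) (v : vert U) :
  stable_tree U -> edge_contraction k X Y -> unslide i X Y R mx my ->
  mx < i -> i < t.+3 -> adj (leaf U ord_max) v -> deg v <= 3 ->
  adj (leaf U' ord_max) (k v) /\ deg (k v) <= 3.
Proof.
move=> sU ec us lti ltm alv dv.
have [bU _ _ _] := sU; have [symU irrU _ _] := bU.
have [iX iY] := unslide_inner sU us; have [ck kl _ _ _] := ec.
have [aiX aXY [aYR nRX Ra] [/andP[nmxi Xmx] _] [[/andP[Ymy nRmy] _] ltmy]] := us.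
have aYX : adj Y X by rewrite symU.
have leaf_lt (l l' : 'I_t.+4) : l < l' -> leaf U l != leaf U l'.
  by move=> lt; rewrite (inj_eq (leaf_inj sU)); apply: contraTneq lt => ->; rewrite ltnn.
have iv := leaf_nbr_inner sU alv; have avl : adj v (leaf U ord_max) by rewrite symU.
have four a b c : a != leaf U ord_max -> b != leaf U ord_max -> c != leaf U ord_max ->
    a != b -> a != c -> b != c -> adj v a -> adj v b -> adj v c -> False.
  move=> na nb nc nab nac nbc ava avb avc.
  suff : 4 <= deg v by rewrite leqNgt ltnS dv.
  apply: (@deg_ge _ _ v [:: leaf U ord_max; a; b; c]) => [|w].
    by rewrite /= !inE !negb_or nab nac nbc !(eq_sym (leaf U ord_max)) na nb nc.
  by rewrite !inE => /or4P[]/eqP->.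
have imax : leaf U i != leaf U ord_max by apply: leaf_lt.
have nvX : v != X.
  apply/eqP => vX; rewrite vX in four alv.
  have [s [aXs nsY smx]] : exists s, [/\ adj X s, s != Y & side s X (leaf U mx)].
    by apply: (side_next bU aYX Xmx); rewrite eq_sym inner_neq.
  have nsl l : l != mx -> s != leaf U l.
    move=> nl; apply: contraNneq nl => e; rewrite e in smx aXs; rewrite symU in aXs.
    exact/eqP/esym/(leaf_inj sU)/(leaf_side sU aXs).
  apply: (four (leaf U i) Y s) => //.
  - exact: inner_neq.
  - by apply: nsl; apply: contraTneq (ltn_trans lti ltm) => <-; rewrite ltnn.
  - by rewrite eq_sym inner_neq.
  - by rewrite eq_sym nsl // eq_sym.
  - by rewrite eq_sym.
  by rewrite symU.
have nvY : v != Y.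
  apply/eqP => vY; rewrite vY in four alv.
  have [s [aYs nsX smy]] : exists s, [/\ adj Y s, s != X & side s Y (leaf U my)].
    by apply: (side_next bU aXY Ymy); rewrite eq_sym inner_neq.
  have nsR : s != R by apply: contraNneq nRmy => <-.
  apply: (four X R s) => //.
  - exact: inner_neq.
  - apply/eqP => e; have alY : adj (leaf U ord_max) Y by rewrite -e symU.
    move: Ra; rewrite e => /(leaf_side sU alY)/(leaf_inj sU)/(congr1 val) /= e0.
    by [].
  - apply/eqP => e; have alY : adj (leaf U ord_max) Y by rewrite -e symU.
    move: smy; rewrite e => /(leaf_side sU alY)/(leaf_inj sU)/(congr1 val) /= e0.
    by have := ltn_trans (ltn_trans ltmy lti) ltm; rewrite e0 ltnn.
  - by rewrite eq_sym.
  - by rewrite eq_sym.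
  by rewrite eq_sym.
rewrite kl; split; last by rewrite (contr_deg ck bU) //; apply: (ec_single ec).
apply: (contr_adj ck) => //; apply: contraTneq alv => /(ec_single ec nvX nvY) ->.
by rewrite irrU.
Qed.

(** * One step, then many steps *)

Lemma star_stable_tree (m : nat) : stable_tree (star m.+3).
Proof.
set S := star m.+3.
have symS : symmetric (@adj _ S) by move=> x y; rewrite /= eq_sym.
have c0 (x : vert S) : connect (@adj _ S) None x.
  by case: x => [l|]; [apply: connect1 | apply: connect0].
split.
- split=> //.
  + by move=> x; rewrite /= eqxx.
  + move=> x y; apply: connect_trans (c0 y).
    by rewrite (sym_connect_sym symS).
  case=> [l|] [l'|] // _; apply/negP => h.
    suff: (None : vert S) = Some l by [].
    apply: (@connect_induct _ _ (fun z : vert S => z = Some l) _ _ _ _ h) => // a [b|] -> //.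
    by case/andP=> _; rewrite !eqxx.
  suff: (Some l' : vert S) <> Some l' by [].
  apply: (@connect_induct _ _ (fun z : vert S => z <> Some l') _ _ _ _ h) => // -[a|] [b|] // _.
  by case/andP=> _ + [e]; rewrite e !eqxx.
- by move=> l l' [].
- move=> l; apply/eqP/cards1P; exists None; apply/setP => -[w|]; by rewrite !inE.
case=> [l|] iv; first by case/negP: iv; apply/codomP; exists l.
apply/card_gt2P; exists (Some (inord 0)), (Some (inord 1)), (Some (inord 2)).
rewrite !inE; split; split=> //; apply/eqP => -[/(congr1 val)] /=; rewrite !inordK //.
Qed.

(** The sets of trees to which a slide can be applied and undone: equality of
    contractions only holds up to isomorphism. *)
Definition tree_class (m : nat) (A : lgraph m -> Prop) : Prop :=
  (forall T, A T -> stable_tree T) /\ (forall T U, A T -> iso T U -> A U).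

Lemma star_class (m : nat) : tree_class (iso (star m.+3)).
Proof.
split=> [T isoT|T U]; first exact: bij_stable_tree isoT (star_stable_tree m).
exact: iso_trans.
Qed.

Lemma slide_class (n : nat) (i : 'I_n.+3) A : tree_class A -> tree_class (slide_set i A).
Proof.
case=> stA isoA; split=> [T [U _]|T U [V AV]].
  by case=> [v [? [? [? [? [_ _ _ _ [_ _ _ /stable_stable_tree]]]]]]].
case=> v [Bra [Brm [l [M [aiv Ba minl Bm [sM BM isoT stT]]]]]] isoTU; exists V => //.
exists v, Bra, Brm, l, M; split=> //; split=> //; first exact: iso_trans isoTU.
exact: stable_tree_stable (bij_stable_tree isoTU (stable_stable_tree stT)).
Qed.

Lemma iter_slide_class (n : nat) (i : 'I_n.+3) k A :
  tree_class A -> tree_class (iter k (slide_set i) A).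
Proof. by move=> cA; elim: k => //= k; apply: slide_class. Qed.

Lemma insert_class (m : nat) (A : lgraph m.+3 -> Prop) : tree_class A -> tree_class (insert_set A).
Proof.
case=> stA isoA; split=> [T [V AV [v iv isoT]]|T U [V AV [v iv isoT]] isoTU].
  by apply: bij_stable_tree isoT _; apply: insert_stable => //; apply: stA.
by exists V => //; exists v => //; apply: iso_trans isoTU.
Qed.

Lemma omega_class (k : nat -> nat) n : tree_class (@Slide_omega_upto k n).
Proof.
elim: n => [|n IHn] /=; first exact: star_class.
by apply: iter_slide_class; apply: insert_class.
Qed.

Lemma ec_unique (m : nat) (U U1 U2 : lgraph m) (g1 : vert U -> vert U1)
    (g2 : vert U -> vert U2) x y :
  edge_contraction g1 x y -> edge_contraction g2 x y -> iso U1 U2.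
Proof.
case=> c1 l1 _ e1 k1 [c2 l2 _ e2 k2].
apply: (iso_of_kernel c1 c2 (iota := id)) => // u w; split.
  by case/k1 => [->|[-> ->]|[-> ->]].
by case/k2 => [->|[-> ->]|[-> ->]].
Qed.

Section StepDuality.
Variables (n : nat) (T : lgraph n.+3).
Hypothesis sT : stable_tree T.
Implicit Types lab : edge_labeling T.

Let bT : bridged T. Proof. by case: sT. Qed.

(** An edge that may be contracted in [T / lab] lifts to an edge of [T], which
    the labeling process may label next. *)
Lemma lift_label lab l X Y r mx my (ty : slide_type) :
  stable_tree (contracted lab) -> unslide l X Y r mx my -> (ty = Omega -> mx < l) ->
  exists lab' (g : vert (contracted lab) -> vert (contracted lab')),
    label_step ty l lab lab' /\ edge_contraction g X Y.
Proof.
move=> sW us om; have [_ aXY _ _ _] := us.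
have [x [y [xE yE axy]]] := contr_lift (contr_mapP bT lab) aXY.
subst X Y.
have nxy := contr_neq (contr_mapP bT lab) aXY.
have [g ec] := add_label_contraction bT l axy nxy.
exists (add_label lab l x y), g; split; last exact: ec.
apply: (proj2 (label_stepP bT ty l _ sW)); exists x, y, r, mx, my.
by split; [exact: us | exact: om | exact: axy |].
Qed.

(** On both sides there is an edge with the property [unslide] whose contraction
    lies in [A]. *)
Lemma psi_step A lab l : tree_class A -> l != label_a -> stable_tree (contracted lab) ->
  slide_set l A (contracted lab) <->
  exists2 lab', label_step Psi l lab lab' & A (contracted lab').
Proof.
move=> [stA isoA] nla sW; split=> [[U AU]|[lab' st AW']].
  case/(slide_unslide nla (stA U AU)) => g [x [y [r [mx [my [ec us]]]]]].
  have [//|lab' [g' [st ec']]] := @lift_label lab l x y r mx my Psi sW us.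
  by exists lab' => //; apply: isoA AU (ec_unique ec ec').
exists (contracted lab') => //.
have [g [v [vbar [r [mx [my [ec us _]]]]]]] := label_step_ec bT sW st.
exact: unslide_slide ec us.
Qed.

Section Pruned.
Variables (t : nat) (h : t <= n).

Definition pruned lab : lgraph t.+3 := prune (contracted lab) h.

Definition stable_stage lab : Prop := stable_tree (contracted lab) /\ stable_tree (pruned lab).

Let to_pruned lab : vert (contracted lab) -> vert (pruned lab) := prune_map h.

Lemma to_prunedP lab : stable_tree (contracted lab) -> pruning (@to_pruned lab).
Proof. exact: prune_map_pruning. Qed.

(** The bound on [mx] makes both minima survive in the pruned tree. *)
Lemma omega_step_down lab lab' (i : 'I_t.+3) :
  stable_stage lab -> label_step Omega (lower h i) lab lab' ->
  exists (k : vert (pruned lab) -> vert (pruned lab')) X Y R mx my,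
    [/\ edge_contraction k X Y, unslide i X Y R mx my & mx < i].
Proof.
move=> [sW sU] st; have sW' := label_step_stable bT sW st.
have [g [x [y [r [mx [my [ec us om]]]]]]] := label_step_ec bT sW st.
have lti := om erefl; have [_ _ _ _ [_ ltm]] := us.
have [ix iy] := unslide_inner sW us.
have mx3 : mx < t.+3 by apply: ltn_trans lti _; rewrite lowerE.
have my3 : my < t.+3 by apply: ltn_trans mx3.
have [k eck] := prune_ec h sW (to_prunedP sW) (to_prunedP sW') ec ix iy.
exists k, (to_pruned x), (to_pruned y), (to_pruned r), (Ordinal mx3), (Ordinal my3); split=> //.
by apply: (unslide_prune sW (to_prunedP sW) _ _ us); apply: val_inj.
Qed.

Lemma omega_step_stage lab lab' (i : 'I_t.+3) :
  stable_stage lab -> label_step Omega (lower h i) lab lab' -> stable_stage lab'.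
Proof.
move=> gl st; have [sW sU] := gl; split; first exact: label_step_stable sW st.
have [k [X [Y [R [mx [my [ec us _]]]]]]] := omega_step_down gl st.
by have [iX iY] := unslide_inner sU us; apply: ec_stable ec iX iY.
Qed.

(** In the pruned tree [ord_max] is the label of the slide, so that [mx] is
    automatically below it and the omega condition imposes nothing more than
    [unslide]. *)
Lemma omega_step A lab : tree_class A -> stable_stage lab ->
  slide_set ord_max A (pruned lab) <->
  exists2 lab', label_step Omega (lower h ord_max) lab lab' & A (pruned lab').
Proof.
move=> [stA isoA] gl; have [sW sU] := gl; split=> [[V AV]|[lab' st AW']].
  have nla : (ord_max : 'I_t.+3) != label_a by [].
  case/(slide_unslide nla (stA V AV)) => g [X [Y [R [mx [my [ec us]]]]]].
  have [x [y [r [xE yE rE usW]]]] := unslide_unprune h sW (to_prunedP sW) us.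
  have lti : lower h mx < lower h ord_max.
    have [_ _ _ [/andP[nm _] _] _] := us.
    by rewrite ltn_neqAle !lowerE -ltnS ltn_ord andbT.
  have [_|lab' [g' [st ec']]] := lift_label sW usW (ty := Omega); first exact: lti.
  exists lab' => //; apply: isoA AV _.
  have [ix iy] := unslide_inner sW usW.
  have sW' := ec_stable sW ec' ix iy.
  have [k] := prune_ec h sW (to_prunedP sW) (to_prunedP sW') ec' ix iy.
  by rewrite xE yE => ek; apply: ec_unique ec ek.
exists (pruned lab') => //.
have [k [X [Y [R [mx [my [ec us _]]]]]]] := omega_step_down gl st.
exact: unslide_slide ec us.
Qed.

End Pruned.

Section Iterate.
Variables (m : nat) (c : edge_labeling T -> lgraph m.+3) (ok : edge_labeling T -> Prop).
Variables (ty : slide_type) (l : 'I_n.+3) (i : 'I_m.+3).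
Hypothesis okP : forall lab lab', ok lab -> label_step ty l lab lab' -> ok lab'.
Hypothesis stepP : forall A lab, tree_class A -> ok lab ->
  slide_set i A (c lab) <-> exists2 lab', label_step ty l lab lab' & A (c lab').

(** The slide nearest to the final tree corresponds to the first labeling step:
    a sequence of slides is undone in the reverse order. *)
Lemma iter_step k A (B : edge_labeling T -> Prop) :
  tree_class A -> (forall lab, B lab -> ok lab) ->
  (exists2 lab', iter k (label_step_set ty l) B lab' & A (c lab')) <->
  (exists2 lab, B lab & iter k (slide_set i) A (c lab)).
Proof.
move=> cA; elim: k B => [|k IHk] B okB //; rewrite iterSr iterS.
rewrite IHk; last by move=> lab' [lab Bl st]; apply: okP (okB _ Bl) st.
split=> [[lab' [lab Bl st] h]|[lab Bl /(stepP (iter_slide_class i k cA) (okB _ Bl))[lab' st h]]].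
  exists lab => //; apply/stepP; [exact: iter_slide_class | exact: okB |].
  by exists lab'.
by exists lab' => //; exists lab.
Qed.

End Iterate.

(** Starting from the labelings in [B], the labels of [s] are treated from the
    last to the first, as in the definition of slide labelings. *)
Definition label_fold (ty : slide_type) (k : n.-tuple nat) (B : edge_labeling T -> Prop)
    (s : seq 'I_n) : edge_labeling T -> Prop :=
  foldr (fun (j : 'I_n) A => iter (tnth k j) (label_step_set ty (num_label j)) A) B s.

Lemma iter_label_inv (I : edge_labeling T -> Prop) ty l k (B : edge_labeling T -> Prop) lab' :
  (forall lab lab', I lab -> label_step ty l lab lab' -> I lab') ->
  (forall lab, B lab -> I lab) -> iter k (label_step_set ty l) B lab' -> I lab'.
Proof.
move=> stI BI; elim: k lab' => [|k IHk] lab' /=; first exact: BI.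
by case=> lab /IHk; apply: stI.
Qed.

Lemma iter_label_mono ty l k (B B' : edge_labeling T -> Prop) lab' :
  (forall lab, B lab -> B' lab) -> iter k (label_step_set ty l) B lab' ->
  iter k (label_step_set ty l) B' lab'.
Proof.
move=> BB'; elim: k lab' => [|k IHk] lab' /=; first exact: BB'.
by case=> lab /IHk h st; exists lab.
Qed.

Lemma iter_label_union ty l k (B : edge_labeling T -> Prop) lab' :
  iter k (label_step_set ty l) B lab' ->
  exists2 lab, B lab & iter k (label_step_set ty l) (eq lab) lab'.
Proof.
elim: k lab' => [|k IHk] lab' /=; first by exists lab'.
by case=> lab1 /IHk[lab Bl h] st; exists lab => //; exists lab1.
Qed.

Lemma label_fold_inv (I : edge_labeling T -> Prop) ty k (B : edge_labeling T -> Prop) s lab' :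
  (forall j lab lab', j \in s -> I lab -> label_step ty (num_label j) lab lab' -> I lab') ->
  (forall lab, B lab -> I lab) -> label_fold ty k B s lab' -> I lab'.
Proof.
elim: s lab' => [|j s IHs] lab' stI BI; first exact: BI.
apply: iter_label_inv => lab; first by move=> lab1; apply: stI; rewrite mem_head.
by apply: IHs => // j' lab1 lab2 js; apply: stI; rewrite inE js orbT.
Qed.

Lemma label_fold_mono ty k (B B' : edge_labeling T -> Prop) s lab' :
  (forall lab, B lab -> B' lab) -> label_fold ty k B s lab' -> label_fold ty k B' s lab'.
Proof.
move=> BB'; elim: s lab' => [|j s IHs] lab'; first exact: BB'.
exact: iter_label_mono.
Qed.

(** The whole process starts from a single labeling, although the sets of
    labelings are propagated at once. *)
Lemma label_fold_union ty k (B : edge_labeling T -> Prop) s lab' :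
  label_fold ty k B s lab' -> exists2 lab, B lab & label_fold ty k (eq lab) s lab'.
Proof.
elim: s lab' => [|j s IHs] lab'; first by exists lab'.
case/iter_label_union => lab1 /IHs[lab Bl h] h'; exists lab => //.
by apply: iter_label_mono h' => _ <-.
Qed.

Lemma iter_label_card ty l k (B : edge_labeling T -> Prop) N lab' :
  (forall lab, B lab -> stable_tree (contracted lab) /\ #|vert (contracted lab)| = N) ->
  iter k (label_step_set ty l) B lab' ->
  stable_tree (contracted lab') /\ #|vert (contracted lab')| + k = N.
Proof.
move=> hB; elim: k lab' => [|k IHk] lab' /=; first by rewrite addn0; apply: hB.
case=> lab /IHk[sW <-] st; split; first exact: label_step_stable sW st.
by rewrite -(label_step_card bT sW st) addnS.
Qed.

Lemma label_fold_card ty k (B : edge_labeling T -> Prop) s N lab' :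
  (forall lab, B lab -> stable_tree (contracted lab) /\ #|vert (contracted lab)| = N) ->
  label_fold ty k B s lab' ->
  stable_tree (contracted lab') /\ #|vert (contracted lab')| + \sum_(j <- s) tnth k j = N.
Proof.
move=> hB; elim: s lab' => [|j s IHs] lab' /=; first by rewrite big_nil addn0; apply: hB.
rewrite big_cons => h.
have hs lab : label_fold ty k B s lab -> stable_tree (contracted lab) /\
    #|vert (contracted lab)| = N - \sum_(j <- s) tnth k j.
  by case/IHs => sW <-; split=> //; rewrite addnK.
have [lab0 /IHs[_ e]  _] := iter_label_union h.
by have [sW e'] := iter_label_card hs h; split=> //; rewrite addnA e' subnK // -e leq_addl.
Qed.

Definition no_label : edge_labeling T := [ffun=> None].

Lemma iso_no_label : iso T (contracted no_label).
Proof.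
have [_ irrT _ _] := bT.
apply: (contr_iso irrT (contr_mapP bT no_label)) => // x y /(contr_mapE bT).
by apply: connect_const => u w /andP[_]; rewrite ffunE.
Qed.

Lemma slide_labelingE ty k : @slide_labeling n ty k T = label_fold ty k (eq no_label) (enum 'I_n).
Proof. by rewrite /slide_labeling foldl_rev. Qed.

Lemma labeling_card ty k lab : slide_labeling ty k lab ->
  stable_tree (contracted lab) /\ #|vert (contracted lab)| + \sum_(j < n) tnth k j = #|vert T|.
Proof.
rewrite slide_labelingE => /label_fold_card; rewrite big_enum /=; apply=> _ <-.
have isoT := iso_no_label; split; first exact: bij_stable_tree isoT sT.
by have [f [bf _ _]] := isoT; rewrite (bij_eq_card bf).
Qed.

(** The contraction by [lab] is stable, so it has at least [n + 4] vertices, and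
    at least [n] vertices have been lost on the way from [T]. *)
Lemma labeling_trivalent ty k : n <= \sum_(i < n) tnth k i ->
  admits_slide_labeling ty k T -> trivalent T.
Proof.
move=> hk [lab /labeling_card[sW e]]; apply: card_trivalent => //.
by move: (stable_card_le sT) (stable_card_ge sW); lia.
Qed.

(** From at most [2 n + 4] vertices at least [n] are lost, which leaves at most
    [n + 4]. *)
Lemma labeling_one_inner ty (k : n.-tuple nat) lab : n <= \sum_(i < n) tnth k i ->
  slide_labeling ty k lab -> one_inner (contracted lab).
Proof.
move=> hk /labeling_card[sW e]; apply: card_one_inner => //.
by move: (stable_card_le sT); lia.
Qed.

End StepDuality.

(** * From the star to the labelings *)

Definition slide_fold (n : nat) (k : n.-tuple nat) (A : lgraph n.+3 -> Prop) (s : seq 'I_n) :=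
  foldl (fun A (j : 'I_n) => iter (tnth k j) (slide_set (num_label j)) A) A s.

Lemma slide_fold_class n (k : n.-tuple nat) A s : tree_class A -> tree_class (slide_fold k A s).
Proof.
by elim: s A => //= j s IHs A cA; apply: IHs; apply: iter_slide_class.
Qed.

Section Main.
Variables (n : nat) (k : n.-tuple nat) (T : lgraph n.+3).
Hypothesis sT : stable_tree T.

Implicit Types lab : edge_labeling T.

Let bT : bridged T. Proof. by case: sT. Qed.

(** Induction on the last label of [s], which is the first to be labeled and the
    last to be slid. *)
Lemma psi_fold s A (B : edge_labeling T -> Prop) : tree_class A ->
  (forall lab, B lab -> stable_tree (contracted lab)) ->
  (exists2 lab', label_fold Psi k B s lab' & A (contracted lab')) <->
  (exists2 lab, B lab & slide_fold k A s (contracted lab)).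
Proof.
move=> cA; elim/last_ind: s B => [|s j IHs] B okB //.
rewrite /label_fold foldr_rcons /slide_fold foldl_rcons.
have okP (lab lab' : edge_labeling T) : stable_tree (contracted lab) ->
    label_step Psi (num_label j) lab lab' -> stable_tree (contracted lab').
  by move=> sW st; apply: (label_step_stable bT sW st).
rewrite [X in X <-> _]IHs; last first.
  by move=> lab; apply: iter_label_inv okB => *; apply: okP; eauto.
apply: (@iter_step n T n (@contracted n T) (fun lab => stable_tree (contracted lab)))
  => //; last exact: slide_fold_class.
by move=> A' lab cA'; apply: psi_step.
Qed.

Lemma psi_labeling : n <= \sum_(i < n) tnth k i ->
  Slide_psi k T <-> admits_slide_labeling Psi k T.
Proof.
move=> hk; have cS := star_class n; have [_ isoS] := slide_fold_class k (enum 'I_n) cS.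
have isoT := iso_no_label sT; have sW := bij_stable_tree isoT sT.
have okE lab : no_label T = lab -> stable_tree (contracted lab) by move=> <-.
have fE := @psi_fold (enum 'I_n) _ (eq (no_label T)) cS okE.
split=> [psiT|[lab labT]].
  have [|lab' h _] := proj2 fE; last by exists lab'; rewrite slide_labelingE.
  by exists (no_label T) => //; apply: isoS isoT.
have [sW' _] := labeling_card sT labT.
have [|_ <-] := proj1 fE.
  exists lab; first by rewrite -slide_labelingE.
  exact/one_inner_star/(labeling_one_inner sT hk labT).
by move/isoS; apply; apply: iso_sym.
Qed.

Lemma mem_take_enum t (j : 'I_n) : j \in take t (enum 'I_n) -> j < t.
Proof.
move/(map_f val); rewrite map_take val_enum_ord take_iota mem_iota /= add0n.
by rewrite ltn_min => /andP[].
Qed.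

Lemma take_enumS t (ht : t < n) : take t.+1 (enum 'I_n) = rcons (take t (enum 'I_n)) (Ordinal ht).
Proof.
rewrite (take_nth (Ordinal ht)) ?size_enum_ord //; congr rcons; apply: val_inj.
by rewrite /= nth_enum_ord.
Qed.

Lemma num_lower t (ht : t < n) : num_label (Ordinal ht) = lower ht ord_max.
Proof. exact: val_inj. Qed.

Lemma num_lower_lt t (ht : t <= n) (j : 'I_n) : j < t ->
  exists2 i : 'I_t.+3, i = j.+3 :> nat & num_label j = lower ht i.
Proof.
move=> jt; have i3 : j.+3 < t.+3 by [].
by exists (Ordinal i3) => //; apply: val_inj.
Qed.

Lemma omega_iter t (ht : t < n) A lab : tree_class A -> stable_stage ht lab ->
  (exists2 lab', iter (tnth k (Ordinal ht)) (label_step_set Omega (num_label (Ordinal ht)))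
     (eq lab) lab' & A (pruned ht lab')) <->
  iter (nth 0 k t) (slide_set ord_max) A (pruned ht lab).
Proof.
move=> cA gl; rewrite (tnth_nth 0) num_lower.
have okE lab' : lab = lab' -> stable_stage ht lab' by move=> <-.
have stepG lab1 lab2 : stable_stage ht lab1 ->
    label_step Omega (lower ht ord_max) lab1 lab2 -> stable_stage ht lab2.
  exact: omega_step_stage.
have stepE A' lab1 := @omega_step n T sT t.+1 ht A' lab1.
have [h1 h2] := iter_step stepG stepE (nth 0 k t) cA okE.
split=> [/h1[_ <-] //|h]; apply: h2.
by exists lab.
Qed.

Lemma pruned_step t (ht : t < n) (ht' : t <= n) lab : stable_tree (contracted lab) ->
  exists q : vert (pruned ht lab) -> vert (pruned ht' lab), @pruning t.+1 t _ _ q.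
Proof. move=> sW; exact: prune_step (to_prunedP ht sW) (to_prunedP ht' sW). Qed.

(** Undo the slides of the last label, then the insertion of its leaf, which is
    a pruning, and go on with one label less. *)
Lemma omega_to_labeling t (ht : t <= n) lab : stable_stage ht lab ->
  Slide_omega_upto (nth 0 k) (pruned ht lab) ->
  exists lab', label_fold Omega k (eq lab) (take t (enum 'I_n)) lab'.
Proof.
elim: t ht lab => [|t IHt] ht lab gl; first by rewrite take0; exists lab.
have ht' := ltnW ht; have cA := omega_class (nth 0 k) t; have [stA isoA] := cA.
rewrite /= => /(omega_iter (insert_class cA) gl)[lab1 st [V AV [v iv isoV]]].
have [sW1 sU1] : stable_stage ht lab1.
  apply: iter_label_inv st => [lab2 lab3|_ <- //].
  by rewrite num_lower; apply: omega_step_stage.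
have [q qP] := insert_iso_prune sU1 (stA V AV) isoV.
have [q' qP'] := pruned_step ht ht' sW1.
have isoVP := prune_unique (leqnSn t) sU1 qP qP'.
have AP := isoA _ _ AV isoVP.
have [lab' h] := IHt ht' lab1 (conj sW1 (stA _ AP)) AP.
exists lab'; rewrite take_enumS /label_fold foldr_rcons.
by apply: label_fold_mono h => _ <-.
Qed.

Lemma one_inner_pruned t (ht : t <= n) lab : stable_tree (contracted lab) ->
  one_inner (contracted lab) -> one_inner (pruned ht lab).
Proof.
move=> sW one u w; have pp := to_prunedP ht sW; have [cp pl pb pk] := pp.
suff h (z : vert (pruned ht lab)) : inner z -> exists2 a, inner a & prune_map ht a = z.
  by move=> /h[a ia <-] /h[b ib <-]; rewrite (one a b).
have [z0 <-] := contr_surj cp z; have [a ta <-] := prune_retract sW pp z0 => iz.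
exists a => //; apply: contraTT iz => /innerPn[l al]; rewrite negbK al.
move: ta; rewrite al (kept_leaf _ _ (leaf_inj sW)) => lt.
by rewrite -(pl (Ordinal lt) l) // codom_f.
Qed.

(** After the steps of the last label its leaf has to be removed, so its
    neighbour [w0] must have at least four neighbours. Otherwise the
    remaining steps keep this leaf at a vertex with three neighbours, which
    contradicts the shape of the final tree. *)
Lemma labeling_to_omega t (ht : t <= n) lab lab' : stable_stage ht lab ->
  label_fold Omega k (eq lab) (take t (enum 'I_n)) lab' -> one_inner (contracted lab') ->
  Slide_omega_upto (nth 0 k) (pruned ht lab).
Proof.
elim: t ht lab => [|t IHt] ht lab gl.
  rewrite take0 /= => <- one; have [sW sU] := gl.
  exact/one_inner_star/one_inner_pruned.
have ht' := ltnW ht; have cA := omega_class (nth 0 k) t.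
rewrite take_enumS /label_fold foldr_rcons => /label_fold_union[lab1 st h] one.
rewrite /=; apply/(omega_iter (insert_class cA) gl); exists lab1 => //.
have [sW1 sU1] : stable_stage ht lab1.
  apply: iter_label_inv st => [lab2 lab3|_ <- //].
  by rewrite num_lower; apply: omega_step_stage.
have [w0 aw0 _] := leaf_nbr sU1 ord_max.
have [q qP] := pruned_step ht ht' sW1.
have wide : 3 < deg w0.
  rewrite ltnNge; apply/negP => narrow.
  pose I lab2 := stable_stage ht lab2 /\
    exists2 v, adj (leaf (pruned ht lab2) ord_max) v & deg v <= 3.
  have : I lab'.
    apply: (label_fold_inv _ _ h) => [j lab2 lab3 js [gl2 [v av dv]]|_ <-]; last first.
      by split=> //; exists w0.
    have jt := mem_take_enum js; have [i ij ->] := num_lower_lt ht (ltnW jt) => st2.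
    split; first exact: omega_step_stage st2.
    have [r [X [Y [R [mx [my [ec us lti]]]]]]] := omega_step_down sT gl2 st2.
    have it : i < t.+3 by rewrite ij.
    have [_ sU2] := gl2.
    have [av' dv'] := narrow_unslide sU2 ec us lti it av dv.
    by exists (r v).
  case=> [[sW' sU'] [v av]]; apply/negP; rewrite -ltnNge.
  exact: one_inner_wide sU' (one_inner_pruned sW' one) av.
have sP := prune_stable sU1 qP aw0 (wide_nbr wide).
have AP := IHt ht' lab1 (conj sW1 sP) h one.
have [v iv isoV] := prune_insert_iso sU1 qP.
by exists (pruned ht' lab1) => //; exists v.
Qed.

Lemma omega_labeling : n <= \sum_(i < n) tnth k i ->
  Slide_omega k T <-> admits_slide_labeling Omega k T.
Proof.
move=> hk; have [_ isoA] := omega_class (nth 0 k) n.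
have isoT := iso_no_label sT; have sW := bij_stable_tree isoT sT.
have isoP := prune_full sW (to_prunedP (leqnn n) sW).
have isoTP := iso_trans isoT isoP.
have gl : stable_stage (leqnn n) (no_label T) by split=> //; apply: bij_stable_tree isoP sW.
have tE : take n (enum 'I_n) = enum 'I_n by rewrite take_oversize // size_enum_ord.
split=> [omT|[lab labT]].
  have [|lab] := omega_to_labeling gl; first exact: isoA omT isoTP.
  by rewrite tE -slide_labelingE; exists lab.
apply: isoA (iso_sym isoTP); apply: (labeling_to_omega (lab' := lab) gl).
  by rewrite tE -slide_labelingE.
exact: labeling_one_inner hk labT.
Qed.

End Main.

Theorem theorem3p14 (n : nat) (k : n.-tuple nat)
    (hk : n <= \sum_(i < n) tnth k i) :
  (forall T : lgraph n.+3,
      Slide_omega k T <-> trivalent T /\ admits_slide_labeling Omega k T) /\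
  (forall T : lgraph n.+3,
      Slide_psi k T <-> trivalent T /\ admits_slide_labeling Psi k T).
Proof.
have [stO _] := omega_class (nth 0 k) n.
have [stP _] := slide_fold_class k (enum 'I_n) (star_class n).
split=> T; split=> [slT|[tT labT]].
- have sT := stO T slT; have labT := proj1 (omega_labeling sT hk) slT.
  by split=> //; apply: labeling_trivalent hk labT.
- by apply/omega_labeling => //; apply/stable_stable_tree/trivalent_stable.
- have sT := stP T slT; have labT := proj1 (psi_labeling sT hk) slT.
  by split=> //; apply: labeling_trivalent hk labT.
by apply/psi_labeling => //; apply/stable_stable_tree/trivalent_stable.
Qed.
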